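(* $\mathrm E_\theta[1/F]<\infty$ if and only if $\mathrm P_\theta(qR>2)=1$.
   Context: Fix integers $n,p,q\ge1$, a $p\times q$ real matrix $\theta$ and a $p\times p$ symmetric positive definite matrix $\Sigma$. The random $p\times q$ matrix $X\sim\mathcal N_{p\times q}(\theta,\Sigma\otimes I_q)$ has independent columns, the $j$-th column being $\mathcal N_p(\theta_{\cdot j},\Sigma)$. The random $nq\times p$ matrix $Y\sim\mathcal N_{nq\times p}(0,I_{nq}\otimes(\Sigma/q))$ has i.i.d. rows distributed as $\mathcal N_p(0,\Sigma/q)$. Set $S=Y^{\top}Y$; $X$ and $S$ are independent. $\mathrm P_\theta,\mathrm E_\theta$ denote probability and expectation under this model. $S^{+}$ is the Moore–Penrose inverse of $S$, $R=\mathrm{rank}(S)$, and $F=\mathrm{tr}(X^{\top}S^{+}X)$ (which is positive almost surely). *)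

(* Defs.v *)
From HB Require Import structures.
From mathcomp Require Import all_boot all_order all_algebra.
From mathcomp Require Import all_classical all_reals all_analysis.

Set Implicit Arguments.
Unset Strict Implicit.
Unset Printing Implicit Defensive.

Import Order.TTheory GRing.Theory Num.Theory.

Local Open Scope classical_set_scope.
Local Open Scope ring_scope.

Definition posdefmx (R : realType) (k : nat) (M : 'M[R]_k) : Prop :=
  M^T = M /\ forall u : 'cV[R]_k, u != 0 -> 0 < (u^T *m M *m u) 0 0.

Definition is_mpinv (R : realType) (m k : nat)
    (A : 'M[R]_(m, k)) (B : 'M[R]_(k, m)) : Prop :=
  [/\ A *m B *m A = A, B *m A *m B = B,
      (A *m B)^T = A *m B & (B *m A)^T = B *m A].

(* The choice is unambiguous: see [mpinvP] and [is_mpinv_uniq]. *)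
Definition mpinv (R : realType) (m k : nat) (A : 'M[R]_(m, k)) : 'M[R]_(k, m) :=
  xget 0 [set B | is_mpinv A B].

Section mpinv_theory.
Context (R : realType).

Lemma mulmx_tr_eq0 m k (A : 'M[R]_(m, k)) : A *m A^T = 0 -> A = 0.
Proof.
move=> A0; apply/matrixP => i j; rewrite mxE; apply/eqP.
have /eqP : (A *m A^T) i i = 0 by rewrite A0 mxE.
rewrite mxE psumr_eq0 => [|l _]; last by rewrite mxE -expr2 sqr_ge0.
by move=> /allP/(_ j (mem_index_enum _)); rewrite mxE -expr2 sqrf_eq0.
Qed.

Lemma row_free_gram_unit m k (B : 'M[R]_(m, k)) :
  row_free B -> B *m B^T \in unitmx.
Proof.
move=> freeB; rewrite -row_free_unit; apply: inj_row_free => v vBB0.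
have vB0 : v *m B = 0.
  by apply: mulmx_tr_eq0; rewrite trmx_mul mulmxA -(mulmxA v) vBB0 mul0mx.
by apply: (row_free_inj freeB); rewrite vB0 mul0mx.
Qed.

Lemma is_mpinv_uniq m k (A : 'M[R]_(m, k)) (B C : 'M[R]_(k, m)) :
  is_mpinv A B -> is_mpinv A C -> B = C.
Proof.
move=> [ABA BAB sAB sBA] [ACA CAC sAC sCA].
have eAB : A *m B = A *m C.
  by rewrite -[in LHS]ACA -mulmxA -sAC -sAB -trmx_mul mulmxA ABA sAC.
have eBA : B *m A = C *m A.
  by rewrite -[in LHS]ACA -mulmxA mulmxA -sBA -sCA -trmx_mul -mulmxA
             (mulmxA A) ABA sCA.
by rewrite -BAB -mulmxA eAB mulmxA eBA.
Qed.

Lemma is_mpinv_exists m k (A : 'M[R]_(m, k)) : exists B, is_mpinv A B.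
Proof.
pose C := col_base A; pose D := row_base A.
have CDA : C *m D = A := mulmx_base A.
have uD : D *m D^T \in unitmx by exact/row_free_gram_unit/row_base_free.
have uC : C^T *m C \in unitmx.
  rewrite -[X in _ *m X]trmxK; apply: row_free_gram_unit.
  by rewrite /row_free mxrank_tr; exact: col_base_full.
pose GD := invmx (D *m D^T); pose GC := invmx (C^T *m C).
have sGD : GD^T = GD by rewrite trmx_inv trmx_mul trmxK.
have sGC : GC^T = GC by rewrite trmx_inv trmx_mul trmxK.
pose Dp := D^T *m GD; pose Cp := GC *m C^T.
have DDp : D *m Dp = 1%:M by rewrite mulmxA mulmxV.
have CpC : Cp *m C = 1%:M by rewrite -mulmxA mulVmx.
have ADp : A *m Dp = C.
  by transitivity (C *m D *m Dp); [rewrite CDA|rewrite -mulmxA DDp mulmx1].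
have CpA : Cp *m A = D.
  by transitivity (Cp *m (C *m D)); [rewrite CDA|rewrite mulmxA CpC mul1mx].
have AB : A *m (Dp *m Cp) = C *m Cp by rewrite mulmxA ADp.
have BA : (Dp *m Cp) *m A = Dp *m D by rewrite -mulmxA CpA.
exists (Dp *m Cp); split.
- by rewrite AB -mulmxA CpA CDA.
- by rewrite BA -mulmxA (mulmxA D) DDp mul1mx.
- by rewrite AB (trmx_mul C) (trmx_mul GC) trmxK sGC mulmxA.
- by rewrite BA (trmx_mul Dp) (trmx_mul _ GD) trmxK sGD mulmxA.
Qed.

Lemma mpinvP m k (A : 'M[R]_(m, k)) : is_mpinv A (mpinv A).
Proof.
rewrite /mpinv; case: xgetP => [B _ //|noB].
by have [B hB] := is_mpinv_exists A; case: (noB B).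
Qed.

End mpinv_theory.

(* Matrices carry the sigma-algebra generated by their entries. *)
Definition measure_matrix_display : measure_display -> measure_display.
Proof. exact. Qed.

Definition mx_cylinder d (T : measurableType d) (m k : nat) :
    set_system 'M[T]_(m, k) :=
  [set A | exists i j, exists2 B : set T, measurable B &
     A = (fun M : 'M[T]_(m, k) => M i j) @^-1` B].

Section measurable_matrix.
Context d (T : measurableType d) (m k : nat).

Let matrix_set0 : <<s @mx_cylinder d T m k >> set0.
Proof. exact: sigma_algebra0. Qed.

Let matrix_setC A :
  <<s @mx_cylinder d T m k >> A -> <<s @mx_cylinder d T m k >> (~` A).
Proof. exact: sigma_algebraC. Qed.

Let matrix_bigcup (F : (set 'M[T]_(m, k))^nat) :
  (forall i, <<s @mx_cylinder d T m k >> (F i)) ->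
  <<s @mx_cylinder d T m k >> (\bigcup_i F i).
Proof. exact: sigma_algebra_bigcup. Qed.

HB.instance Definition _ := @isMeasurable.Build (measure_matrix_display d)
  'M[T]_(m, k) <<s @mx_cylinder d T m k >> matrix_set0 matrix_setC matrix_bigcup.

End measurable_matrix.

Definition independent d d1 d2 (T : measurableType d) (T1 : measurableType d1)
    (T2 : measurableType d2) (R : realType) (P : probability T R)
    (X : T -> T1) (Y : T -> T2) : Prop :=
  forall (A : set T1) (B : set T2), measurable A -> measurable B ->
    P (X @^-1` A `&` Y @^-1` B) = (P (X @^-1` A) * P (Y @^-1` B))%E.

(* Product rules over subfamilies are the instances where the remaining [B i]
   are [setT]. *)
Definition mutually_independent d d1 (T : measurableType d)
    (T1 : measurableType d1) (R : realType) (P : probability T R)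
    (I : finType) (X : I -> T -> T1) : Prop :=
  forall B : I -> set T1, (forall i, measurable (B i)) ->
    P (\bigcap_i (X i @^-1` B i)) = (\prod_i P (X i @^-1` B i))%E.

Definition standard_normal_vector d (T : measurableType d) (R : realType)
    (P : probability T R) (k : nat) (Z : T -> 'cV[R]_k) : Prop :=
  [/\ measurable_fun [set: T] Z,
      forall i (B : set R), measurable B ->
        P [set w | B (Z w i 0)] = normal_prob 0 1 B
    & mutually_independent P (fun i w => Z w i 0)].

(* N_k(mu, V), as the affine images mu + A Z of standard normal vectors Z with
   A A^T = V.  When V is positive definite, A is invertible, so that Z is a
   function of X and this is a property of the law of X alone. *)
Definition normal_vector d (T : measurableType d) (R : realType)
    (P : probability T R) (k : nat) (mu : 'cV[R]_k) (V : 'M[R]_k)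
    (X : T -> 'cV[R]_k) : Prop :=
  exists (A : 'M[R]_k) (Z : T -> 'cV[R]_k),
    [/\ A *m A^T = V, standard_normal_vector P Z
      & forall w, X w = mu + A *m Z w].

(* N_{k x l}(theta, V (x) I_l) *)
Definition normal_indep_columns d (T : measurableType d) (R : realType)
    (P : probability T R) (k l : nat) (theta : 'M[R]_(k, l)) (V : 'M[R]_k)
    (X : T -> 'M[R]_(k, l)) : Prop :=
  mutually_independent P (fun j w => col j (X w)) /\
  forall j, normal_vector P (col j theta) V (fun w => col j (X w)).

(* N_{l x k}(theta, I_l (x) V) *)
Definition normal_indep_rows d (T : measurableType d) (R : realType)
    (P : probability T R) (k l : nat) (theta : 'M[R]_(l, k)) (V : 'M[R]_k)
    (Y : T -> 'M[R]_(l, k)) : Prop :=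
  mutually_independent P (fun i w => row i (Y w)) /\
  forall i, normal_vector P (row i theta)^T V (fun w => (row i (Y w))^T).

(* Main.v *)
(** Given [S = s], the columns of [X] are affine images of independent standard
normal vectors, so [X] is an affine image of a [p x q] matrix [W] of independent
[N(0,1)] entries, and [F] is comparable to the sum of the squares of [q * rank s]
linearly independent linear forms in a translate of [W].  Such forms can be brought to
triangular shape, each having an entry of [W] with coefficient 1 which does not
occur in the later ones; integrating these entries out one after the other shows
that [m] such forms are simultaneously at most [e] in absolute value with
probability of exact order [e^m].  Summing over dyadic [e], the conditional
expectation of [1/F] is infinite when [1 <= q * rank s <= 2], and at most a
constant times [tr s] when [q * rank s >= 3]; the bound is uniform in [s] because
[F >= |proj X|^2 / tr s], where [proj] projects onto the range of [s].  It remains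
to use that [E (tr S)] is finite and that [S <> 0] almost surely. *)
Require Import Defs.
From HB Require Import structures.
From mathcomp Require Import all_boot all_order all_algebra.
From mathcomp Require Import all_classical all_reals all_analysis.
From mathcomp Require Import measurable_realfun.
From mathcomp Require Import ring lra.

Set Implicit Arguments.
Unset Strict Implicit.
Unset Printing Implicit Defensive.

Import Order.TTheory GRing.Theory Num.Theory.
Import numFieldNormedType.Exports.

Local Open Scope classical_set_scope.
Local Open Scope ring_scope.

(** * Measurability of matrix operations *)

Section matrix_measurability.
Context d (T : measurableType d) (R : realType).
Implicit Types m k l : nat.

(** The linear forms depend on the range of [s], so the constants need care. The upper half needs
    one constant for all [s]: the small-ball upper bound uses only that each pivot is 1, and
    pivoting on an entry of largest modulus keeps all coefficients in [-1, 1], which bounds the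
    norms met when forms are compared with [F]. The lower half tolerates constants depending on [s],
    since infinity is reached for each [s] separately. The threshold 2 is a comparison of powers:
    [F] is quadratic, so [F] near [4^-k] means forms of size [2^-k], an event of probability about
    [2^-(m k)] on which [1/F] is about [4^k]. Two obstacles shape the rest. Since [0^-1 = 0],
    divergence can be claimed only where [F] is almost surely nonzero, and rank 0 must be excluded
    on its own. And independence is assumed between [X] and [S], so the integrand has to be a
    measurable function of that pair; this requires the Moore-Penrose inverse, a discontinuous map,
    to be measurable. *)

Lemma measurable_mx_entry m k i j :
  measurable_fun [set: 'M[R]_(m, k)] (fun M => M i j).
Proof.
move=> _ B mB; rewrite setTI; apply: sub_sigma_algebra.
by exists i, j, B.
Qed.

Lemma measurable_mxP m k (f : T -> 'M[R]_(m, k)) :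
  measurable_fun setT f <-> forall i j, measurable_fun setT (fun w => f w i j).
Proof.
split=> [mf i j|mf]; first exact: measurableT_comp (measurable_mx_entry i j) mf.
apply: (@measurability _ _ _ _ _ _ (@mx_cylinder _ R m k)) => // _ [_ [i [j [B mB ->]]] <-].
exact: mf.
Qed.

Lemma measurable_mulmx m k l (f : T -> 'M[R]_(m, k)) (g : T -> 'M[R]_(k, l)) :
  measurable_fun setT f -> measurable_fun setT g ->
  measurable_fun setT (fun w => f w *m g w).
Proof.
move=> /measurable_mxP mf /measurable_mxP mg; apply/measurable_mxP => i j.
under eq_fun do rewrite mxE.
by apply: measurable_sum => a; apply: measurable_funM.
Qed.

Lemma measurable_addmx m k (f g : T -> 'M[R]_(m, k)) :
  measurable_fun setT f -> measurable_fun setT g ->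
  measurable_fun setT (fun w => f w + g w).
Proof.
move=> /measurable_mxP mf /measurable_mxP mg; apply/measurable_mxP => i j.
under eq_fun do rewrite mxE.
exact: measurable_funD.
Qed.

Lemma measurable_trmx m k (f : T -> 'M[R]_(m, k)) :
  measurable_fun setT f -> measurable_fun setT (fun w => (f w)^T).
Proof.
move=> /measurable_mxP mf; apply/measurable_mxP => i j.
under eq_fun do rewrite mxE.
exact: mf.
Qed.

Lemma measurable_mxtrace m (f : T -> 'M[R]_m) :
  measurable_fun setT f -> measurable_fun setT (fun w => \tr (f w)).
Proof. by move=> /measurable_mxP mf; apply: measurable_sum => i. Qed.

Lemma measurable_det m (f : T -> 'M[R]_m) :
  measurable_fun setT f -> measurable_fun setT (fun w => \det (f w)).
Proof.
move=> /measurable_mxP mf; apply: measurable_sum => s.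
by apply: measurable_funM => //; apply: measurable_prod.
Qed.

Lemma measurable_funV (f : T -> R) :
  measurable_fun setT f -> measurable_fun setT (fun w => (f w)^-1).
Proof.
move=> mf; apply: (@measurableT_comp _ _ _ _ _ _ (@GRing.inv R)) => //.
(* With [0^-1 = 0] inversion is discontinuous at 0 only, so the point 0 is split off. *)
rewrite -(setvU [set 0]); apply/measurable_funU => //; first exact: measurableC.
split; last exact: measurable_fun_set1.
apply: open_continuous_measurable_fun.
  exact/closed_openC/accessible_closed_set1/hausdorff_accessible.
by move=> x; rewrite inE => /eqP x0; exact: inv_continuous.
Qed.

Lemma measurable_invmx m (f : T -> 'M[R]_m) :
  (forall w, f w \in unitmx) ->
  measurable_fun setT f -> measurable_fun setT (fun w => invmx (f w)).
Proof.
move=> uf mf; apply/measurable_mxP => i j.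
under eq_fun do rewrite /invmx uf !mxE.
apply: measurable_funM; first exact/measurable_funV/measurable_det.
apply: measurable_funM => //; apply: measurable_det; apply/measurable_mxP => a b.
under eq_fun do rewrite !mxE.
by move/measurable_mxP: mf; apply.
Qed.

End matrix_measurability.

(** * The Frobenius inner product *)

Section frobenius.
Context (R : realType).

Definition mxdot m k (A B : 'M[R]_(m, k)) : R := \sum_i \sum_j A i j * B i j.

Lemma mxdotE m k (A B : 'M[R]_(m, k)) : mxdot A B = \tr (A^T *m B).
Proof.
rewrite /mxdot exchange_big /=; apply: eq_bigr => j _; rewrite mxE.
by apply: eq_bigr => i _; rewrite !mxE.
Qed.

Lemma mxdotC m k (A B : 'M[R]_(m, k)) : mxdot A B = mxdot B A.
Proof. by apply: eq_bigr => i _; apply: eq_bigr => j _; rewrite mulrC. Qed.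

Lemma mxdot_mull m k l (A : 'M[R]_(m, k)) (B : 'M[R]_(k, l)) C :
  mxdot (A *m B) C = mxdot B (A^T *m C).
Proof. by rewrite !mxdotE trmx_mul mulmxA. Qed.

Lemma mxdot_ge0 m k (A : 'M[R]_(m, k)) : 0 <= mxdot A A.
Proof. by apply: sumr_ge0 => i _; apply: sumr_ge0 => j _; rewrite -expr2 sqr_ge0. Qed.

Lemma mxdotDl m k (A B C : 'M[R]_(m, k)) :
  mxdot (A + B) C = mxdot A C + mxdot B C.
Proof. by rewrite !mxdotE linearD /= mulmxDl linearD. Qed.

Lemma mxdotZl m k a (A C : 'M[R]_(m, k)) : mxdot (a *: A) C = a * mxdot A C.
Proof. by rewrite !mxdotE linearZ /= -scalemxAl linearZ. Qed.

Lemma mxdotDr m k (A B C : 'M[R]_(m, k)) :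
  mxdot C (A + B) = mxdot C A + mxdot C B.
Proof. by rewrite !(mxdotC C) mxdotDl. Qed.

Lemma mxdotZr m k a (A C : 'M[R]_(m, k)) : mxdot C (a *: A) = a * mxdot C A.
Proof. by rewrite !(mxdotC C) mxdotZl. Qed.

Lemma mxdot_eq0 m k (A : 'M[R]_(m, k)) : (mxdot A A == 0) = (A == 0).
Proof.
apply/eqP/eqP => [|->]; last by rewrite mxdotE trmx0 mul0mx linear0.
move=> A0; apply/matrixP => i j; rewrite mxE; apply/eqP; rewrite -sqrf_eq0.
have rge0 a : 0 <= \sum_b A a b * A a b.
  by apply: sumr_ge0 => b _; rewrite -expr2 sqr_ge0.
move/eqP: A0; rewrite psumr_eq0 // => /allP /(_ i (mem_index_enum _)) /=.
rewrite psumr_eq0 => [/allP /(_ j (mem_index_enum _))|b _]; first by rewrite expr2.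
by rewrite -expr2 sqr_ge0.
Qed.

Lemma mxdot_entry m k (A : 'M[R]_(m, k)) i j : A i j ^+ 2 <= mxdot A A.
Proof.
rewrite /mxdot (bigD1 i) //= (bigD1 j) //= -addrA expr2 lerDl addr_ge0 //.
  by apply: sumr_ge0 => b _; rewrite -expr2 sqr_ge0.
by apply: sumr_ge0 => a _; apply: sumr_ge0 => b _; rewrite -expr2 sqr_ge0.
Qed.

Lemma mxdot_CS m k (A B : 'M[R]_(m, k)) :
  mxdot A B ^+ 2 <= mxdot A A * mxdot B B.
Proof.
have [->|B0] := eqVneq B 0.
  by rewrite !mxdotE !mulmx0 !linear0 expr0n /= mulr0.
have BB : 0 < mxdot B B by rewrite lt_def mxdot_eq0 B0 mxdot_ge0.
have := mxdot_ge0 (mxdot B B *: A - mxdot A B *: B).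
rewrite -scaleNr !(mxdotDl, mxdotDr, mxdotZl, mxdotZr) (mxdotC B A).
set x := mxdot B B in BB *; set y := mxdot A B; set z := mxdot A A.
move=> H; have: 0 <= x * (z * x - y ^+ 2).
  by rewrite (le_trans H) // le_eqVlt; apply/orP; left; apply/eqP; ring.
by rewrite pmulr_rge0 // subr_ge0.
Qed.

(** Cauchy-Schwarz for each entry, which pairs a row of [A] with a column of [B]. *)
Lemma mxdot_mulmx_le m k l (A : 'M[R]_(m, k)) (B : 'M[R]_(k, l)) :
  mxdot (A *m B) (A *m B) <= mxdot A A * mxdot B B.
Proof.
have -> : mxdot A A * mxdot B B =
    \sum_i \sum_j (\sum_a A i a * A i a) * (\sum_a B a j * B a j).
  rewrite /mxdot (exchange_big _ _ _ _ _ (fun a j => B a j * B a j)) mulr_suml.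
  by apply: eq_bigr => i _; rewrite mulr_sumr.
apply: ler_sum => i _; apply: ler_sum => j _.
have := mxdot_CS (row i A) (col j B)^T.
rewrite /mxdot !big_ord1 -expr2; congr (_ <= _); last congr (_ * _).
- by congr (_ ^+ 2); rewrite mxE; apply: eq_bigr => a _; rewrite !mxE.
- by apply: eq_bigr => a _; rewrite !mxE.
- by apply: eq_bigr => a _; rewrite !mxE.
Qed.

End frobenius.

(** * The Moore-Penrose inverse as a limit, and the rank as a trace *)

Section mpinv_measurability.
Context (R : realType).

Lemma gram_shift_unit m k (A : 'M[R]_(m, k)) (t : R) :
  0 < t -> A^T *m A + t%:M \in unitmx.
Proof.
move=> t0; rewrite -row_free_unit; apply: inj_row_free => v v0.
have : mxdot v^T ((A^T *m A + t%:M) *m v^T) = 0.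
  rewrite -[X in X *m _]trmxK linearD /= trmx_mul trmxK tr_scalar_mx.
  by rewrite -trmx_mul v0 mxdotE trmx0 mulmx0 linear0.
rewrite mulmxDl mul_scalar_mx mxdotDr mxdotZr -mulmxA -{1}[A]trmxK.
rewrite -[X in mxdot _ (X *m _)]trmxK -mxdot_mull !trmxK => /eqP.
rewrite paddr_eq0 ?mxdot_ge0 ?mulr_ge0 ?mxdot_ge0 ?(ltW t0) //.
case/andP=> _; rewrite mulf_eq0 gt_eqF //= mxdot_eq0 => /eqP vT0.
by rewrite -[v]trmxK vT0 trmx0.
Qed.

(** Pairing the equation with [Z] gives [|A Z|^2 + t |Z|^2 = t <Z, K>], hence [|Z|^2 <= <Z, K>];
    then [|Z - K|^2 >= 0] concludes. *)
Lemma gram_shift_contract m k l (A : 'M[R]_(m, k)) (t : R) (Z K : 'M[R]_(k, l)) :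
  0 < t -> (A^T *m A + t%:M) *m Z = t *: K -> mxdot Z Z <= mxdot K K.
Proof.
move=> t0 eZ.
have : mxdot Z ((A^T *m A + t%:M) *m Z) = t * mxdot Z K by rewrite eZ mxdotZr.
rewrite mulmxDl mul_scalar_mx mxdotDr mxdotZr -mulmxA -mxdot_mull => eq1.
have h : mxdot Z Z <= mxdot Z K.
  by rewrite -(ler_pM2l t0) -eq1 lerDr mxdot_ge0.
have := mxdot_ge0 (Z + (-1) *: K).
rewrite !(mxdotDl, mxdotDr, mxdotZl, mxdotZr) (mxdotC K Z).
by move: h; lra.
Qed.

(** Tikhonov regularisation: continuous approximations of a discontinuous map, with pointwise error
    of order [t = 1/(n+1)]. *)
Lemma mpinv_cvg m k (A : 'M[R]_(m, k)) i j :
  (invmx (A^T *m A + (n.+1%:R^-1)%:M) *m A^T) i j @[n --> \oo] --> mpinv A i j.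
Proof.
have [ABA BAB sAB sBA] := mpinvP A; set B := mpinv A in ABA BAB sAB sBA *.
(* [K] solves [A^T A K = B]; it makes the error of the approximation exactly [t (K - Z)], with [Z] a
   contraction of [K]. *)
pose K := B *m B^T *m B.
have MK : A^T *m A *m K = B.
  have e1 : A^T *m A *m B = A^T by rewrite -mulmxA -{1}sAB -trmx_mul ABA.
  by rewrite /K !mulmxA e1 -trmx_mul sBA BAB.
pose Z n := invmx (A^T *m A + (n.+1%:R^-1)%:M) *m (n.+1%:R^-1 *: K).
(* From [|x| <= x^2 + 1], entries of [K] and of [Z n] are each at most [mxdot K K + 1] in absolute
   value. *)
pose c := 2 * (mxdot K K + 1).
have t0 n : 0 < n.+1%:R^-1 :> R by rewrite invr_gt0.
have eqn n : invmx (A^T *m A + (n.+1%:R^-1)%:M) *m A^T =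
    B - n.+1%:R^-1 *: (K - Z n).
  have u := gram_shift_unit A (t0 n).
  apply: (canLR (mulKmx u)).
  have e1 : A^T *m (A *m B) = A^T by rewrite -{1}sAB -trmx_mul ABA.
  rewrite mulmxBr -scalemxAr mulmxBr /Z mulKVmx // mulmxDl (mulmxDl _ _ K).
  by rewrite !mul_scalar_mx MK -mulmxA e1 addrK addrK.
have bnd n : `|(invmx (A^T *m A + (n.+1%:R^-1)%:M) *m A^T) i j - B i j| <=
    c * n.+1%:R^-1.
  have : mxdot (Z n) (Z n) <= mxdot K K.
    apply: (@gram_shift_contract _ _ _ A _ _ _ (t0 n)).
    by rewrite /Z mulKVmx // gram_shift_unit.
  rewrite eqn; move: (Z n) => Zn hZ; rewrite !mxE addrAC subrr sub0r normrN normrM gtr0_norm // mulrC.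
  rewrite ler_pM2r // (le_trans (ler_normB _ _)) //.
  have H (M : 'M[R]_(k, m)) : mxdot M M <= mxdot K K ->
      `|M i j| <= mxdot K K + 1.
    have := mxdot_entry M i j.
    by rewrite ler_norml; nra.
  rewrite /c mulr_natl mulr2n lerD //; last exact: H.
  by have := H K (lexx _); rewrite {1}/K mxE.
apply/cvgrPdist_le => e e0.
have /cvgrPdist_le/(_ e e0) : c * n.+1%:R^-1 @[n --> \oo] --> (0 : R).
  by rewrite -[X in _ --> X](mulr0 c); apply: cvgMr; exact: cvg_harmonic.
apply: filterS => n; rewrite sub0r normrN distrC => h.
by rewrite (le_trans (bnd n)) // (le_trans (ler_norm _)).
Qed.

Lemma measurable_mpinv d (T : measurableType d) m k (f : T -> 'M[R]_(m, k)) :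
  measurable_fun setT f -> measurable_fun setT (fun w => mpinv (f w)).
Proof.
move=> mf; apply/measurable_mxP => i j.
apply: (@measurable_fun_cvg _ _ _ _
  (fun n w => (invmx ((f w)^T *m f w + (n.+1%:R^-1)%:M) *m (f w)^T) i j)).
  move=> n; move: i j; apply/(measurable_mxP (fun w => _ *m (f w)^T)).
  apply: measurable_mulmx.
    apply: measurable_invmx => [w|]; first by apply: gram_shift_unit; rewrite invr_gt0.
    apply: measurable_addmx; last exact: measurable_cst.
    by apply: measurable_mulmx => //; exact: measurable_trmx.
  exact: measurable_trmx.
by move=> w _; exact: mpinv_cvg.
Qed.

Lemma mxtrace_idempotent m (A : 'M[R]_m) : A *m A = A -> \tr A = (\rank A)%:R.
Proof.
move=> AA; have CD := mulmx_base A.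
suff DC : row_base A *m col_base A = 1%:M.
  by rewrite -{1}CD mxtrace_mulC DC mxtrace1.
apply: (row_free_inj (row_base_free A)).
apply: (row_full_inj (col_base_full A)).
by rewrite mul1mx -(mulmxA (row_base A)) CD mulmxA CD AA.
Qed.

(** [A *m mpinv A] is the projection onto the column space of [A]. The formula makes the rank of a
    random matrix measurable. *)
Lemma mxtrace_mul_mpinv m k (A : 'M[R]_(m, k)) :
  \tr (A *m mpinv A) = (\rank A)%:R.
Proof.
have [ABA BAB _ _] := mpinvP A.
rewrite mxtrace_idempotent ?mulmxA ?ABA //; congr (_%:R); apply/eqP.
by rewrite eqn_leq mxrankM_maxl -{1}ABA mxrankM_maxl.
Qed.

End mpinv_measurability.

(** * Independence, normal probabilities and dyadic sums *)

Section independence.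
Context d d1 d2 (T : measurableType d) (T1 : measurableType d1)
  (T2 : measurableType d2) (R : realType) (P : probability T R).
Local Open Scope ereal_scope.

(** The joint law agrees with the product law on rectangles, hence everywhere; Tonelli does the
    rest. *)
Lemma independent_integral_mfun (X : {mfun T >-> T1}) (Y : {mfun T >-> T2})
    (f : T1 * T2 -> \bar R) :
  independent P X Y -> measurable_fun setT f -> (forall z, 0 <= f z) ->
  measurable_fun setT (fun w' => \int[P]_w f (X w, Y w')) /\
  \int[P]_w f (X w, Y w) = \int[P]_w' \int[P]_w f (X w, Y w').
Proof.
move=> iXY mf f0.
have mXY : measurable_fun setT (fun w => (X w, Y w)).
  by apply/measurable_fun_pair.
pose mXY_mixin := isMeasurableFun.Build _ _ _ _ _ mXY.
pose XY : {mfun T >-> (T1 * T2)%type} := HB.pack (fun w => (X w, Y w)) mXY_mixin.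
have lawE A : measurable A ->
    (distribution P X \x distribution P Y) A = distribution P XY A.
  by apply: product_measure_unique => B C mB mC; rewrite -iXY.
have mG : measurable_fun setT (fun y => \int[P]_w f (X w, y)).
  have := measurable_fun_fubini_tonelli_G (m1 := distribution P X) f mf f0.
  congr (measurable_fun _ _); apply/funext => y; rewrite /fubini_G.
  rewrite (@ge0_integral_distribution _ _ _ _ _ P X) //; exact: measurableT_comp.
split; first exact: measurableT_comp mG (measurable_funPT Y).
transitivity (\int[distribution P XY]_z f z).
  by rewrite (@ge0_integral_distribution _ _ _ _ _ P XY).
transitivity (\int[distribution P X \x distribution P Y]_z f z).
  by apply: eq_measure_integral => A mA _; exact: (esym (lawE _ mA)).
rewrite fubini_tonelli2 // (@ge0_integral_distribution _ _ _ _ _ P Y).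
- apply: eq_integral => w' _ /=; rewrite /fubini_G.
  by rewrite (@ge0_integral_distribution _ _ _ _ _ P X) //; exact: measurableT_comp.
- exact: measurable_fun_fubini_tonelli_G.
- by move=> y; apply: integral_ge0.
Qed.

Lemma independent_integral (X : T -> T1) (Y : T -> T2) (f : T1 * T2 -> \bar R) :
  measurable_fun setT X -> measurable_fun setT Y ->
  independent P X Y -> measurable_fun setT f -> (forall z, 0 <= f z) ->
  measurable_fun setT (fun w' => \int[P]_w f (X w, Y w')) /\
  \int[P]_w f (X w, Y w) = \int[P]_w' \int[P]_w f (X w, Y w').
Proof.
move=> mX mY iXY mf f0.
pose X' : {mfun T >-> T1} := HB.pack X (isMeasurableFun.Build _ _ _ _ _ mX).
pose Y' : {mfun T >-> T2} := HB.pack Y (isMeasurableFun.Build _ _ _ _ _ mY).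
exact: (@independent_integral_mfun X' Y').
Qed.

Lemma independent_prob (X : T -> T1) (Y : T -> T2) (A : set (T1 * T2)) :
  measurable_fun setT X -> measurable_fun setT Y ->
  independent P X Y -> measurable A ->
  measurable_fun setT (fun w' => P [set w | A (X w, Y w')]) /\
  P [set w | A (X w, Y w)] = \int[P]_w' P [set w | A (X w, Y w')].
Proof.
move=> mX mY iXY mA.
have mpre (g : T -> T2) : measurable_fun setT g -> measurable [set w | A (X w, g w)].
  move=> mg; have : measurable_fun setT (fun w => (X w, g w)) by exact/measurable_fun_pair.
  by move=> /(_ measurableT A mA); rewrite setTI.
have E (g : T -> T2) : measurable_fun setT g ->
    \int[P]_w (\1_A (X w, g w))%:E = P [set w | A (X w, g w)].
  move=> mg; transitivity (P ([set w | A (X w, g w)] `&` setT)).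
    by rewrite -integral_indic //; exact: mpre.
  by rewrite setIT.
have mf : measurable_fun setT (EFin \o \1_A : T1 * T2 -> \bar R).
  by apply/measurable_EFinP; exact: measurable_indic.
have [|m1 m2] := independent_integral mX mY iXY mf.
  by move=> z; rewrite lee_fin.
split.
  by move: m1; congr (measurable_fun _ _); apply/funext => w' /=; rewrite E.
rewrite -E // m2; apply: eq_integral => w' _ /=; exact: E.
Qed.

End independence.

(** * Small balls and tails of the standard normal law *)

Section normal_bounds.
Context (R : realType).
Local Open Scope ereal_scope.

Lemma normal_pdf01E (x : R) :
  (normal_pdf 0 1 x = normal_peak 1 * expR (- (x ^+ 2 / 2)))%R.
Proof.
rewrite normal_pdfE ?oner_neq0 // /normal_fun subr0 expr1n.
by congr (_ * expR _)%R; rewrite -mulr_natl mulr1 mulNr.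
Qed.

Lemma set_ballE (m e : R) :
  [set x | `|x + m| <= e]%R = `[(- m - e)%R, (- m + e)%R]%classic.
Proof.
by apply/seteqP; split => x /=; rewrite in_itv /= ler_norml => /andP[? ?];
  apply/andP; split; lra.
Qed.

Lemma normal_prob_ball_le (m e : R) : (0 <= e)%R ->
  normal_prob 0 1 [set x | `|x + m| <= e]%R <= (2 * normal_peak 1 * e)%:E.
Proof.
move=> e0; rewrite set_ballE /normal_prob.
apply: (@le_trans _ _ (\int[lebesgue_measure]_(x in `[(- m - e)%R, (- m + e)%R])
    (normal_peak 1)%:E)).
  apply: ge0_le_integral => //.
  - by move=> x _; rewrite lee_fin normal_pdf_ge0.
  - apply/measurable_EFinP; apply: measurable_funTS; exact: measurable_normal_pdf.
  - by move=> x _; rewrite lee_fin normal_pdf_ub ?oner_neq0.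
rewrite integral_cst //= lebesgue_measure_itv /= lte_fin.
case: ifPn => _; last first.
  by rewrite mule0 lee_fin !mulr_ge0 // normal_peak_ge0.
rewrite -EFinD -EFinM lee_fin le_eqVlt; apply/orP; left; apply/eqP; ring.
Qed.

(** The interval lies in [[-(M + 1), M + 1]], where the density is at least its value at [M + 1]. *)
Lemma normal_prob_ball_ge (M : R) : (0 <= M)%R ->
  exists2 c : R, (0 < c)%R & forall m e : R, (`|m| <= M)%R -> (0 < e <= 1)%R ->
    (c * e)%:E <= normal_prob 0 1 [set x | `|x + m| <= e]%R.
Proof.
move=> M0.
have p0 : (0 < normal_peak 1 :> R)%R by rewrite normal_peak_gt0 ?oner_neq0.
pose c := (normal_peak 1 * expR (- ((M + 1) ^+ 2 / 2)))%R.
have c0 : (0 < c)%R by rewrite mulr_gt0 // expR_gt0.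
exists (2 * c)%R; first by rewrite mulr_gt0.
move=> m e mM /andP[e0 e1]; rewrite set_ballE /normal_prob.
apply: (@le_trans _ _ (\int[lebesgue_measure]_(x in `[(- m - e)%R, (- m + e)%R]) c%:E)).
  rewrite integral_cst //= lebesgue_measure_itv /= lte_fin ifT; last by lra.
  by rewrite -EFinD -EFinM lee_fin le_eqVlt; apply/orP; left; apply/eqP; ring.
apply: ge0_le_integral => //.
- by move=> x _; rewrite lee_fin ltW.
- by apply/measurable_EFinP; apply: measurable_funTS; exact: measurable_normal_pdf.
- move=> x; rewrite /= in_itv /= => /andP[x1 x2].
  rewrite lee_fin normal_pdf01E ler_pM2l // ler_expR.
  move: mM; rewrite ler_norml => /andP[mM1 mM2].
  have h1 : (0 <= M + 1 - x)%R by lra.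
  have h2 : (0 <= M + 1 + x)%R by lra.
  have := mulr_ge0 h1 h2.
  by rewrite lerN2 ler_pM2r ?invr_gt0 // !expr2; lra.
Qed.

(** Cubic decay is the rate [8^-k] at [t = 2^k] that the dyadic criterion asks for. It follows by
    dominating [|x|^3] times the density by a multiple of the normal density of standard deviation
    2. *)
Lemma normal_prob_tail_le : exists2 C : R, (0 <= C)%R & forall t : R, (0 < t)%R ->
  normal_prob 0 1 [set x | t <= `|x|]%R <= (C / t ^+ 3)%:E.
Proof.
pose p1 : R := normal_peak 1; pose p2 : R := normal_peak 2.
have p10 : (0 < p1)%R by rewrite normal_peak_gt0 ?oner_neq0.
have p20 : (0 < p2)%R by rewrite normal_peak_gt0.
pose C := (p1 * 30 / p2)%R.
have C0 : (0 <= C)%R by rewrite divr_ge0 ?mulr_ge0 // ltW.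
exists C => // t t0; rewrite /normal_prob.
have mS : measurable [set x : R | t <= `|x|]%R.
  rewrite -[X in measurable X]setTI.
  exact: (measurable_fun_ler (measurable_cst t) (@normr_measurable R setT)).
have pw (x : R) : (`|x| ^+ 3 * normal_pdf 0 1 x <= C * normal_pdf 0 2 x)%R.
  rewrite normal_pdf01E normal_pdfE // /normal_fun subr0 -/p1 -/p2.
  have -> z : (C * (p2 * z) = p1 * (30 * z))%R by rewrite /C; field; rewrite gt_eqF.
  rewrite mulrCA ler_pM2l //.
  (* The exponents differ by [1/2 - 1/8 = 3/8]. It remains to see [|x|^3 <= 30 exp y], from
     [exp y >= (1 + y/2)^2]; the factor 30 makes the coefficient of [x^4] exceed 1. *)
  set y := (3 / 8 * x ^+ 2)%R.
  have -> : (- (x ^+ 2 / 2) = - (x ^+ 2) / (2 ^+ 2 *+ 2) - y)%R.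
    by rewrite /y -mulr_natl; field.
  rewrite expRD mulrCA mulrC ler_pM2r ?expR_gt0 //.
  rewrite expRN ler_pdivrMr ?expR_gt0 //.
  have y0 : (0 <= y)%R by rewrite mulr_ge0 // sqr_ge0.
  have e1 : ((1 + y / 2) ^+ 2 <= expR y)%R.
    have -> : (expR y = expR (y / 2) ^+ 2)%R by rewrite expr2 -expRD; congr expR; field.
    by rewrite lerXn2r ?nnegrE ?expR_ge0 ?expR_ge1Dx //; lra.
  have := normr_ge0 x; have : (x ^+ 2 = `|x| ^+ 2)%R by rewrite real_normK ?num_real.
  rewrite /y in e1 y0 *; move=> x2; rewrite x2 in e1 y0 *; move: (`|x|%R) e1 => z e1 z0.
  apply: (@le_trans _ _ (30 * (1 + 3 / 8 * z ^+ 2 / 2) ^+ 2)%R); last by rewrite ler_pM2l.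
  have : (0 <= (z ^+ 2 - z / 2) ^+ 2)%R by rewrite sqr_ge0.
  have : (0 <= z ^+ 2 * z ^+ 2)%R by rewrite mulr_ge0 ?sqr_ge0.
  have := sqr_ge0 z.
  by rewrite !exprS !expr0; nra.
apply: (@le_trans _ _ (\int[lebesgue_measure]_(x in [set x | t <= `|x|]%R)
    (C / t ^+ 3 * normal_pdf 0 2 x)%:E)).
  apply: ge0_le_integral => //.
  - by move=> x _; rewrite lee_fin normal_pdf_ge0.
  - apply/measurable_EFinP; apply: measurable_funTS; exact: measurable_normal_pdf.
  - apply/measurable_EFinP; apply: measurable_funTS; apply: measurable_funM => //.
    exact: measurable_normal_pdf.
  - move=> x /= tx; rewrite lee_fin mulrAC ler_pdivlMr ?exprn_gt0 // mulrC.
    rewrite (le_trans _ (pw x)) // ler_wpM2r ?normal_pdf_ge0 //.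
    by rewrite lerXn2r ?nnegrE ?normr_ge0 // ltW.
apply: (@le_trans _ _ (\int[lebesgue_measure]_x (C / t ^+ 3 * normal_pdf 0 2 x)%:E)).
  apply: ge0_subset_integral => //.
  - apply/measurable_EFinP; apply: measurable_funM => //.
    exact: measurable_normal_pdf.
  - by move=> x _; rewrite lee_fin mulr_ge0 ?normal_pdf_ge0 // divr_ge0 // exprn_ge0 // ltW.
under eq_integral do rewrite EFinM.
rewrite ge0_integralZl_EFin ?integral_normal_pdf ?mule1 //.
- by move=> x _; rewrite lee_fin normal_pdf_ge0.
- by apply/measurable_EFinP; exact: measurable_normal_pdf.
- by rewrite divr_ge0 // exprn_ge0 // ltW.
Qed.

End normal_bounds.

(** * Dyadic criteria for the expectation of an inverse *)

Section dyadic_integrals.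
Context d (T : measurableType d) (R : realType) (P : probability T R).
Local Open Scope ereal_scope.

Lemma measurable_le_set (f : T -> R) r :
  measurable_fun setT f -> measurable [set w | f w <= r]%R.
Proof.
move=> mf; rewrite -[X in measurable X]setTI.
exact: (measurable_fun_ler mf (measurable_cst r)).
Qed.

(** For [0 < x < 1] one term suffices: if [k + 1] is the least exponent with [4^-(k+1) < x], then
    [x <= 4^-k] and [1/x <= 4^(k+1)]. At [x = 0] the left side is 0. *)
Lemma inv_dyadic_ub (x : R) : (0 <= x)%R ->
  (x^-1)%:E <= 1 + \sum_(k <oo) ((4 ^+ k.+1)%:E * (x <= 4 ^- k)%R%:R%:E) :> \bar R.
Proof.
have ge0 k : 0 <= (4 ^+ k.+1)%:E * (x <= 4 ^- k)%R%:R%:E :> \bar R.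
  by rewrite -EFinM lee_fin mulr_ge0 ?exprn_ge0.
rewrite le_eqVlt => /predU1P[<-|x0].
  by rewrite invr0 adde_ge0 // nneseries_ge0.
have [x1|x1] := leP 1%R x.
  by rewrite (@le_trans _ _ 1) ?leeDl ?nneseries_ge0 // lee_fin invf_le1.
have ex : exists n, (4 ^- n < x)%R.
  have [n] : exists n, (x^-1 < n%:R)%R.
    by exists (Num.truncn x^-1).+1; rewrite truncnS_gt.
  move=> xn; exists n; rewrite invf_plt ?posrE ?exprn_gt0 // (lt_le_trans xn) //.
  by rewrite -natrX ler_nat ltnW // ltn_expl.
have [[|k] kP kmin] := ex_minnP ex.
  by move: kP; rewrite expr0 invr1 ltNge (ltW x1).
have xk : (x <= 4 ^- k)%R by rewrite leNgt; apply/negP => /kmin; rewrite ltnn.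
apply: (@le_trans _ _ (4 ^+ k.+1)%:E).
  by rewrite lee_fin -[leRHS]invrK lef_pV2 ?posrE ?invr_gt0 ?exprn_gt0 // ltW.
have := @nneseries_lim_ge R (fun k => (4 ^+ k.+1)%:E * (x <= 4 ^- k)%R%:R%:E)
  xpredT 0 k.+1 (fun n _ _ => ge0 n).
rewrite big_nat_recr //= xk mule1 => h.
apply: (le_trans _ (leeDr _ _)) => //; apply: le_trans h.
by rewrite leeDr // sume_ge0.
Qed.

(** The [k]-th dyadic term contributes at most [4^(k+1) C 8^-k = 8 C / 2^(k+1)], and these sum to
    [8 C]. *)
Lemma integral_inv_le (f : T -> R) (C : R) :
  measurable_fun setT f -> (forall w, 0 <= f w)%R -> (0 <= C)%R ->
  (forall k, P [set w | f w <= 4 ^- k]%R <= (C * 8 ^- k)%:E) ->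
  \int[P]_w ((f w)^-1)%:E <= (1 + 8 * C)%:E.
Proof.
move=> mf f0 C0 fP.
pose g k w : \bar R := (4 ^+ k.+1)%:E * (\1_[set w | f w <= 4 ^- k]%R w)%:E.
have mind k : measurable_fun setT (fun w => (\1_[set w | f w <= 4 ^- k]%R w)%:E : \bar R).
  by apply/measurable_EFinP; apply: measurable_indic; exact: measurable_le_set.
have g0 k w : 0 <= g k w by rewrite /g -EFinM lee_fin mulr_ge0 ?exprn_ge0.
have mg k : measurable_fun setT (g k).
  by apply: emeasurable_funM => //; exact: measurable_cst.
apply: (@le_trans _ _ (\int[P]_w (1 + \sum_(k <oo) g k w))).
  apply: ge0_le_integral => //.
  - by move=> w _; rewrite lee_fin invr_ge0.
  - by apply/measurable_EFinP; exact: measurable_funV.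
  - by apply: emeasurable_funD => //; apply: ge0_emeasurable_sum.
  - move=> w _; rewrite (le_trans (inv_dyadic_ub (f0 w))) // leeD2l //.
    apply: lee_nneseries => k _; first by move=> _; apply: mule_ge0; rewrite lee_fin ?exprn_ge0.
    rewrite /g indicE.
    by rewrite (_ : (w \in _) = (f w <= 4 ^- k)%R) //; apply/idP/idP; rewrite inE.
rewrite ge0_integralD //; last 2 first.
- by move=> w _; rewrite nneseries_ge0.
- by apply: ge0_emeasurable_sum.
rewrite integral_cst // mul1e EFinD; apply: leeD; first exact: probability_le1.
rewrite integral_nneseries //.
rewrite (le_trans _ (@epsilon_trick0 _ (8 * C) xpredT _)) ?mulr_ge0 //.
apply: lee_nneseries => k _; first by move=> _; exact: integral_ge0.
rewrite /g ge0_integralZl_EFin ?exprn_ge0 //.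
rewrite integral_indic //; last exact: measurable_le_set.
rewrite setIT; apply: (@le_trans _ _ ((4 ^+ k.+1)%:E * (C * 8 ^- k)%:E)).
  by apply: lee_wpmul2l; [rewrite lee_fin exprn_ge0|exact: fP].
rewrite -EFinM lee_fin le_eqVlt; apply/orP; left; apply/eqP.
have -> : (8 ^- k = 2 ^- k * 4 ^- k :> R)%R.
  by rewrite -invfM -exprMn; rewrite -natrM.
rewrite natrX !exprS; field.
by rewrite !expf_neq0.
Qed.

(** Every dyadic level contributes at least [c] to the sum of [4^k P(f <= 4^-k)]. The hypothesis on
    [f = 0] is essential, as there [(f w)^-1] is 0. *)
Lemma integral_inv_infty (f : T -> R) (c : R) :
  measurable_fun setT f -> (forall w, 0 <= f w)%R -> (0 < c)%R ->
  P [set w | f w = 0%R] = 0 ->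
  (forall k, (c * 4 ^- k)%:E <= P [set w | f w <= 4 ^- k]%R) ->
  \int[P]_w ((f w)^-1)%:E = +oo.
Proof.
move=> mf f0 c0 Pf0 fP.
have mfV : measurable_fun setT (fun w => ((f w)^-1)%:E).
  by apply/measurable_EFinP; exact: measurable_funV.
have m0 : measurable [set w | f w = 0%R].
  by have := mf measurableT _ (measurable_set1 0%R); rewrite setTI.
pose g k w : \bar R := (4 ^+ k)%:E * (\1_[set w | f w <= 4 ^- k]%R w)%:E.
have mind k : measurable_fun setT (fun w => (\1_[set w | f w <= 4 ^- k]%R w)%:E : \bar R).
  by apply/measurable_EFinP; apply: measurable_indic; exact: measurable_le_set.
have g0 k w : 0 <= g k w by rewrite /g -EFinM lee_fin mulr_ge0 ?exprn_ge0.
have mg k : measurable_fun setT (g k).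
  by apply: emeasurable_funM => //; exact: measurable_cst.
(* The nonzero terms form a geometric sum, at most [4/3] times the last one, which is at most
   [1 / f w]. *)
have gE N w : (0 < f w)%R -> \sum_(k < N) g k w <= (2 * (f w)^-1)%:E.
  move=> fw; elim: N => [|N IH].
    by rewrite big_ord0 lee_fin mulr_ge0 // invr_ge0.
  have [fN|fN] := leP (f w) (4 ^- N)%R; last first.
    rewrite big_ord_recr /= /g indicE memNset ?mule0 ?adde0 //=.
    by apply/negP; rewrite -ltNge.
  have sumE M : \sum_(k < M) g k w <= ((4 ^+ M - 1) / 3)%:E.
    elim: M => [|M IHM]; first by rewrite big_ord0 expr0 subrr mul0r.
    rewrite big_ord_recr /=; apply: (@le_trans _ _ (((4 ^+ M - 1) / 3)%:E + (4 ^+ M)%:E)).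
      apply: leeD => //; rewrite /g -EFinM lee_fin ler_piMr ?exprn_ge0 // indicE.
    rewrite -EFinD lee_fin le_eqVlt; apply/orP; left; apply/eqP.
    by rewrite exprS; field.
  apply: (le_trans (sumE _)); rewrite lee_fin.
  have : (4 ^+ N <= (f w)^-1)%R.
    by rewrite -[leLHS]invrK lef_pV2 ?posrE ?invr_gt0 ?exprn_gt0.
  have : (0 <= 4 ^+ N :> R)%R by rewrite exprn_ge0.
  by rewrite exprS; lra.
have main N : (N%:R * c)%:E <= 2%:E * \int[P]_w ((f w)^-1)%:E.
  rewrite -ge0_integralZl_EFin //; last by move=> w _; rewrite lee_fin invr_ge0.
  apply: (@le_trans _ _ (\int[P]_w (\sum_(k < N) g k w))); last first.
    apply: ae_ge0_le_integral => //.
    - by move=> w _; apply: sume_ge0.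
    - exact: emeasurable_sum.
    - by move=> w _; rewrite -EFinM lee_fin mulr_ge0 ?invr_ge0.
    - exact: emeasurable_funM.
    - exists [set w | f w = 0%R]; split => //.
      move=> w /= /not_implyP[_ /negP H]; apply: contrapT => /eqP fw.
      by move/negP: H; apply; rewrite -EFinM; apply: gE; rewrite lt_def fw f0.
  rewrite ge0_integral_sum //.
  elim: N => [|N IH]; first by rewrite big_ord0 mul0r.
  rewrite big_ord_recr /= -natr1 mulrDl mul1r EFinD leeD //.
  rewrite /g ge0_integralZl_EFin ?exprn_ge0 // integral_indic //; last first.
    exact: measurable_le_set.
  rewrite setIT; apply: (@le_trans _ _ ((4 ^+ N)%:E * (c * 4 ^- N)%:E)); last first.
    by apply: lee_wpmul2l; [rewrite lee_fin exprn_ge0|exact: fP].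
  by rewrite -EFinM lee_fin mulrCA mulfV ?mulr1 // expf_neq0.
apply/eqP; rewrite eq_le leey /= leNgt; apply/negP => fin.
have I0 : 0 <= \int[P]_w ((f w)^-1)%:E.
  by apply: integral_ge0 => w _; rewrite lee_fin invr_ge0.
move: (main) fin I0; case: (\int[P]_w _) => [r| |] // mainr _; rewrite lee_fin => r0.
have := mainr (Num.truncn (2 * r / c)).+1; rewrite -EFinM lee_fin leNgt => /negP; apply.
by rewrite -ltr_pdivrMr // truncnS_gt.
Qed.

End dyadic_integrals.

(** * Small ball probabilities of linear forms in Gaussian entries *)

Section gaussian_entries.
Context d (T : measurableType d) (R : realType) (P : probability T R) (p q : nat).
Local Open Scope ereal_scope.

Definition gaussian_entries (W : T -> 'M[R]_(p, q)) : Prop :=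
  [/\ measurable_fun setT W,
      forall i j (B : set R), measurable B ->
        P [set w | B (W w i j)] = normal_prob 0 1 B
    & mutually_independent P (fun (x : 'I_p * 'I_q) w => W w x.1 x.2)].

(** Encodes the family of all entries other than [x] without leaving the matrix type, so that linear
    forms still apply to it. *)
Definition zero_entry (x : 'I_p * 'I_q) (M : 'M[R]_(p, q)) : 'M[R]_(p, q) :=
  \matrix_(a, b) if (a, b) == x then 0%R else M a b.

Lemma measurable_zero_entry x : measurable_fun setT (zero_entry x).
Proof.
apply/measurable_mxP => i j; under eq_fun do rewrite mxE.
case: ((i, j) == x); first exact: measurable_cst.
exact: measurable_mx_entry.
Qed.

(** A generating class closed under intersection, unlike [mx_cylinder]; this is what uniqueness of
    measures requires. *)
Definition mx_box : set_system 'M[R]_(p, q) :=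
  [set A | exists2 B : 'I_p * 'I_q -> set R, (forall x, measurable (B x)) &
     A = [set M : 'M[R]_(p, q) | forall x, B x (M x.1 x.2)]].

Lemma measurable_mx_box A : mx_box A -> measurable A.
Proof.
case=> B mB ->.
have -> : [set M : 'M[R]_(p, q) | forall x, B x (M x.1 x.2)] =
    \bigcap_(x in [set: 'I_p * 'I_q]) (fun M : 'M[R]_(p, q) => M x.1 x.2) @^-1` B x.
  by apply/seteqP; split => M /= h x; [move=> _|]; exact: h.
apply: fin_bigcap_measurable => // x _.
by have := measurable_mx_entry x.1 x.2 measurableT (mB x); rewrite setTI.
Qed.

Lemma measurable_mx_boxE : @measurable _ 'M[R]_(p, q) = <<s mx_box >>.
Proof.
apply/seteqP; split; last first.
  by apply: smallest_sub; [exact: sigma_algebra_measurable|exact: measurable_mx_box].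
apply: smallest_sub; first exact: smallest_sigma_algebra.
move=> _ [i [j [B mB ->]]]; apply: sub_sigma_algebra.
exists (fun x => if x == (i, j) then B else setT); first by move=> x; case: ifP.
apply/seteqP; split => M /=.
  by move=> BM x; case: eqP => // ->.
by move=> /(_ (i, j)); rewrite eqxx.
Qed.

Lemma gaussian_entries_box W (B : 'I_p * 'I_q -> set R) :
  gaussian_entries W -> (forall x, measurable (B x)) ->
  P [set w | forall x, B x (W w x.1 x.2)] = \prod_x normal_prob 0 1 (B x).
Proof.
case=> mW lawW iW mB; have := iW B mB.
rewrite (_ : \bigcap_x _ = [set w | forall x, B x (W w x.1 x.2)]).
  by move=> ->; apply: eq_bigr => x _; exact: lawW.
by apply/seteqP; split => w /= h x; [|move=> _]; exact: h.
Qed.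

(** For fixed [A], both sides are finite measures in the second event; they agree on boxes by mutual
    independence of the entries. *)
Lemma independent_zero_entry W (x : 'I_p * 'I_q) : gaussian_entries W ->
  independent P (fun w => W w x.1 x.2) (fun w => zero_entry x (W w)).
Proof.
move=> gW; have [mW lawW iW] := gW; move=> A C mA mC.
set Z := fun w => _; set V := fun w => zero_entry x (W w).
have mV : measurable_fun setT V by exact: measurableT_comp (measurable_zero_entry x) mW.
have mZ : measurable_fun setT Z.
  exact: measurableT_comp (measurable_mx_entry x.1 x.2) mW.
have mZA : measurable (Z @^-1` A) by have := mZ measurableT _ mA; rewrite setTI.
pose V' : {mfun T >-> 'M[R]_(p, q)} := HB.pack V (isMeasurableFun.Build _ _ _ _ _ mV).
pose PA : R := fine (P (Z @^-1` A)).
have PAE : PA%:E = P (Z @^-1` A) by rewrite fineK // fin_num_measure.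
have PA0 : (0 <= PA)%R by rewrite fine_ge0.
pose m1_ : {measure set 'M[R]_(p, q) -> \bar R} := pushforward (mrestr P mZA) V'.
pose m2_ : {measure set 'M[R]_(p, q) -> \bar R} := mscale (NngNum PA0) (pushforward P V').
pose m1 := m1_ mV; pose m2 := m2_ mV.
have m12 D : measurable D -> m1 D = m2 D.
  apply: (@measure_unique _ _ _ mx_box (fun=> setT)).
  - exact: measurable_mx_boxE.
  - move=> _ _ [B1 mB1 ->] [B2 mB2 ->].
    exists (fun x => B1 x `&` B2 x); first by move=> y; exact: measurableI.
    apply/seteqP; split => M /=; first by case=> h1 h2 y; split.
    by move=> h; split=> y; case: (h y).
  - by move=> _; exists (fun=> setT) => //; apply/seteqP; split.
  - by apply/seteqP; split => // M _; exists 0%N.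
  - move=> _ [B mB ->].
    rewrite /m1 /m2 /m1_ /m2_ /= /mscale /= /pushforward /mrestr /= PAE.
    pose B1 y := if y == x then A else B y.
    pose B2 y := if y == x then setT else B y.
    have mB1 y : measurable (B1 y) by rewrite /B1; case: ifP.
    have mB2 y : measurable (B2 y) by rewrite /B2; case: ifP.
    (* [zero_entry x] always has 0 at [x]: a box whose side there misses 0 is never entered, and
       otherwise that side is no constraint. *)
    have [B0|B0] := pselect (B x 0%R); last first.
      have -> : V @^-1` [set M : 'M[R]_(p, q) | forall y, B y (M y.1 y.2)] = set0.
        rewrite -subset0 => w /= /(_ x); rewrite mxE -surjective_pairing eqxx.
        by move=> /B0.
      rewrite set0I !measure0. by rewrite mule0.
    have VB w : (forall y, B y (V w y.1 y.2)) <-> (forall y, B2 y (W w y.1 y.2)).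
      split=> h y; have := h y; rewrite /B2 mxE -surjective_pairing;
      by case: eqP => // ->.
    have -> : V @^-1` [set M : 'M[R]_(p, q) | forall y, B y (M y.1 y.2)] `&` Z @^-1` A =
        [set w | forall y, B1 y (W w y.1 y.2)].
      apply/seteqP; split => w /=.
        move=> [/VB h hA] y; have := h y; rewrite /B1 /B2; by case: eqP => // ->.
      move=> h; split.
        by apply/VB => y; have := h y; rewrite /B1 /B2; case: eqP.
      by have := h x; rewrite /B1 eqxx.
    have -> : V @^-1` [set M : 'M[R]_(p, q) | forall y, B y (M y.1 y.2)] =
        [set w | forall y, B2 y (W w y.1 y.2)].
      by apply/seteqP; split => w /= /VB.
    rewrite !gaussian_entries_box // (bigD1 x) //= [in RHS](bigD1 x) //=.
    have -> : P (Z @^-1` A) = normal_prob 0 1 A by exact: lawW.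
    rewrite {1}/B1 {1}/B2 eqxx (@probability_setT _ _ _ (normal_prob 0%R 1%R)) mul1e.
    congr (_ * _).
    by apply: eq_bigr => y yx; rewrite /B1 /B2 (negbTE yx).
  - move=> _; rewrite /m1 /m1_ /= /pushforward /mrestr /=.
    by rewrite (le_lt_trans (probability_le1 P _)) ?ltry // preimage_setT setTI.
have := m12 C mC; rewrite /m1 /m2 /m1_ /m2_ /= /mscale /= /pushforward /mrestr /= PAE => <-.
by rewrite setIC.
Qed.

End gaussian_entries.

Section small_ball.
Context d (T : measurableType d) (R : realType) (P : probability T R) (p q : nat).
Context (W : T -> 'M[R]_(p, q)) (gW : gaussian_entries P W).
Local Open Scope ereal_scope.
Implicit Types (x : 'I_p * 'I_q) (C : set 'M[R]_(p, q)) (g : 'M[R]_(p, q) -> R).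

Let mW : measurable_fun setT W. Proof. by case: gW. Qed.

Let mV x : measurable_fun setT (fun w => zero_entry x (W w)).
Proof. exact: measurableT_comp (measurable_zero_entry x) mW. Qed.

Let mZ x : measurable_fun setT (fun w => W w x.1 x.2).
Proof. exact: measurableT_comp (measurable_mx_entry x.1 x.2) mW. Qed.

Let mVC x C : measurable C -> measurable [set w | C (zero_entry x (W w))].
Proof. by move=> mC; have := mV x measurableT mC; rewrite setTI. Qed.

Lemma measurable_shift_ball g C (e : R) :
  measurable_fun setT g -> measurable C ->
  measurable [set z : R * 'M[R]_(p, q) | (`|z.1 + g z.2| <= e)%R /\ C z.2].
Proof.
move=> mg mC; apply: measurableI; last first.
  by have := @measurable_snd _ _ R 'M[R]_(p, q) measurableT _ mC; rewrite setTI.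
rewrite -[X in measurable X]setTI.
apply: (measurable_fun_ler _ (measurable_cst e)) => //.
apply: measurableT_comp => //; apply: measurable_funD; first exact: measurable_fst.
by apply: measurableT_comp mg _; exact: measurable_snd.
Qed.

Lemma pull_entryE x g C (e : R) : measurable_fun setT g -> measurable C ->
  measurable_fun setT (fun w' =>
    normal_prob 0 1 [set z | `|z + g (zero_entry x (W w'))| <= e]%R) /\
  P [set w | (`|W w x.1 x.2 + g (zero_entry x (W w))| <= e)%R /\ C (zero_entry x (W w))] =
  \int[P]_(w' in [set w' | C (zero_entry x (W w'))])
     normal_prob 0 1 [set z | `|z + g (zero_entry x (W w'))| <= e]%R.
Proof.
move=> mg mC.
have ind := independent_zero_entry x gW.
have fibE (t : R) : P [set w | `|W w x.1 x.2 + t| <= e]%R =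
    normal_prob 0 1 [set z | `|z + t| <= e]%R.
  have [_ lawW _] := gW; apply: (lawW x.1 x.2 [set z | `|z + t| <= e]%R).
  by rewrite set_ballE; exact: measurable_itv.
split.
  have [+ _] := independent_prob (mZ x) (mV x) ind
    (measurable_shift_ball e mg measurableT).
  congr (measurable_fun _ _); apply/funext => w'; rewrite -fibE; congr (P _).
  by apply/seteqP; split => w //= [].
have [_ ->] := independent_prob (mZ x) (mV x) ind (measurable_shift_ball e mg mC).
rewrite [RHS]integral_mkcond; apply: eq_integral => w' _; rewrite patchE /=.
case: ifPn; rewrite ?inE => Cw'.
  by rewrite -fibE; congr (P _); apply/seteqP; split => w //= [].
rewrite (_ : [set w | _] = set0) ?measure0 // -subset0 => w /= [_ Cw].
by move/negP: Cw'; apply; rewrite inE.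
Qed.

Lemma pull_entry_le x g C (e : R) : (0 <= e)%R ->
  measurable_fun setT g -> measurable C ->
  P [set w | (`|W w x.1 x.2 + g (zero_entry x (W w))| <= e)%R /\ C (zero_entry x (W w))] <=
  (2 * normal_peak 1 * e)%:E * P [set w | C (zero_entry x (W w))].
Proof.
move=> e0 mg mC; have [m1 ->] := pull_entryE x e mg mC.
rewrite -integral_cst; last exact: mVC.
apply: ge0_le_integral; first exact: mVC.
- by move=> w _; exact: measure_ge0.
- exact: measurable_funTS.
- exact: measurable_cst.
- by move=> w _; exact: normal_prob_ball_le.
Qed.

(** The normal density has no positive lower bound on the line, so the shift [g] must be bounded; a
    bound where the entry [x] vanishes is enough, as [g] is evaluated only there. *)
Lemma pull_entry_ge (M : R) : (0 <= M)%R -> exists2 c : R, (0 < c)%R &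
  forall x g C (e : R), measurable_fun setT g -> measurable C -> (0 < e <= 1)%R ->
  (forall v, C v -> v x.1 x.2 = 0 -> `|g v| <= M)%R ->
  (c * e)%:E * P [set w | C (zero_entry x (W w))] <=
  P [set w | (`|W w x.1 x.2 + g (zero_entry x (W w))| <= e)%R /\ C (zero_entry x (W w))].
Proof.
move=> M0; have [c c0 cP] := normal_prob_ball_ge M0; exists c => //.
move=> x g C e mg mC e01 gM; have [m1 ->] := pull_entryE x e mg mC.
rewrite -integral_cst; last exact: mVC.
apply: ge0_le_integral; first exact: mVC.
- by move=> w _; rewrite lee_fin mulr_ge0 // ltW //; case/andP: e01.
- exact: measurable_cst.
- exact: measurable_funTS.
- move=> w /= Cw; apply: cP => //; apply: gM => //.
  by rewrite mxE -surjective_pairing eqxx.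
Qed.

End small_ball.

(** * Small balls of triangular systems of forms *)

Section triangular_systems.
Context (R : realType) (p q : nat).
Local Notation form := (('I_p * 'I_q) * 'M[R]_(p, q))%type.

(* Each form comes with the position of its pivot. *)
Fixpoint triangular (s : seq form) : Prop :=
  if s is (x, c) :: s' then
    [/\ c x.1 x.2 = 1, forall y, y \in s' -> y.2 x.1 x.2 = 0 & triangular s']
  else True.

Lemma mxdot_zero_entry x (c M : 'M[R]_(p, q)) :
  mxdot c M = c x.1 x.2 * M x.1 x.2 + mxdot c (zero_entry x M).
Proof.
rewrite /mxdot !pair_bigA /= (bigD1 x) //= [in RHS](bigD1 x) //=.
rewrite mxE -surjective_pairing eqxx mulr0 add0r; congr (_ + _).
by apply: eq_bigr => y yx; rewrite mxE -surjective_pairing (negbTE yx).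
Qed.

Lemma measurable_mxdot (c : 'M[R]_(p, q)) : measurable_fun setT (mxdot c).
Proof.
apply: measurable_sum => i; apply: measurable_sum => j.
by apply: measurable_funM => //; exact: measurable_mx_entry.
Qed.

Lemma measurable_mxdot_shift (c z : 'M[R]_(p, q)) :
  measurable_fun setT (fun M : 'M[R]_(p, q) => mxdot c (M + z)).
Proof.
by under eq_fun do rewrite mxdotDr; apply: measurable_funD => //; exact: measurable_mxdot.
Qed.

Definition all_small (z : 'M[R]_(p, q)) (s : seq form) (e : R) : set 'M[R]_(p, q) :=
  [set M | forall y, y \in s -> `|mxdot y.2 (M + z)| <= e].

Lemma all_small_cons z x c s e : all_small z ((x, c) :: s) e =
  [set M | `|mxdot c (M + z)| <= e] `&` all_small z s e.
Proof.
apply/seteqP; split => M /=.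
  move=> h; split=> [|y ys]; first by apply: (h (x, c)); rewrite mem_head.
  by apply: h; rewrite inE ys orbT.
by case=> h1 h2 y; rewrite inE => /predU1P[->|/h2].
Qed.

Lemma measurable_form_ball c (z : 'M[R]_(p, q)) e :
  measurable [set M : 'M[R]_(p, q) | `|mxdot c (M + z)| <= e].
Proof.
rewrite -[X in measurable X]setTI.
apply: (measurable_fun_ler _ (measurable_cst e)) => //.
by apply: measurableT_comp => //; exact: measurable_mxdot_shift.
Qed.

Lemma measurable_all_small z s e : measurable (all_small z s e).
Proof.
elim: s => [|[x c] s IH].
  by rewrite (_ : all_small _ _ _ = setT) //; apply/seteqP; split.
by rewrite all_small_cons; apply: measurableI => //; exact: measurable_form_ball.
Qed.

Lemma all_small_zero_entry z x (s : seq form) e M :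
  (forall y, y \in s -> y.2 x.1 x.2 = 0) ->
  all_small z s e (zero_entry x M) <-> all_small z s e M.
Proof.
move=> s0; split=> h y ys; have := h y ys;
  by rewrite !mxdotDr (mxdot_zero_entry x y.2 M) s0 // mul0r add0r.
Qed.

Context d (T : measurableType d) (P : probability T R).
Context (W : T -> 'M[R]_(p, q)) (gW : gaussian_entries P W).
Local Open Scope ereal_scope.

Let measurable_preW C : measurable C -> measurable [set w | C (W w)].
Proof. by case: gW => mW _ _ mC; have := mW measurableT C mC; rewrite setTI. Qed.

(** The bound involves neither [z] nor the coefficients off the pivots; the uniformity in [y] of the
    upper estimate rests on this. *)
Lemma prob_all_small_le z s e : triangular s -> (0 <= e)%R ->
  P [set w | all_small z s e (W w)] <= ((2 * normal_peak 1 * e) ^+ size s)%:E.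
Proof.
move=> + e0; elim: s => [_|[x c] s IH [cx s0 ts]].
  rewrite expr0; apply: probability_le1; apply: measurable_preW.
  exact: measurable_all_small.
have ce : (0 <= 2 * normal_peak 1 * e :> R)%R by rewrite !mulr_ge0 // normal_peak_ge0.
rewrite all_small_cons.
have -> : [set w | ([set M | `|mxdot c (M + z)| <= e]%R `&` all_small z s e) (W w)] =
  [set w | (`|W w x.1 x.2 + mxdot c (zero_entry x (W w) + z)| <= e)%R /\
           all_small z s e (zero_entry x (W w))].
  apply/seteqP; split => w /=; rewrite all_small_zero_entry //;
  by rewrite !mxdotDr (mxdot_zero_entry x c (W w)) cx mul1r addrA.
apply: le_trans (pull_entry_le gW x e0 (measurable_mxdot_shift c z)
  (measurable_all_small z s e)) _.
rewrite /= exprS [leRHS]EFinM; apply: lee_wpmul2l => //.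
rewrite (_ : [set w | _] = [set w | all_small z s e (W w)]); first exact: IH.
by apply/seteqP; split => w /=; rewrite all_small_zero_entry.
Qed.

(* The entries in [X], the pivots already used, are left unconstrained: the
   remaining forms do not involve them. *)
Let bounded_off (X : seq ('I_p * 'I_q)) (K : R) : set 'M[R]_(p, q) :=
  [set M | forall x, x \notin X -> `|M x.1 x.2| <= K]%R.

Let measurable_bounded_off X K : measurable (bounded_off X K).
Proof.
apply: measurable_mx_box.
exists (fun x => if x \in X then setT else [set r : R | `|r| <= K]%R).
  move=> x; case: ifP => // _; have := set_ballE 0%R K.
  under eq_set do rewrite addr0.
  by move=> ->; exact: measurable_itv.
apply/seteqP; split => M /= h x; last by have := h x; case: ifP.
by case: ifPn => // /h.
Qed.

Let measurable_small_bounded z s e X K :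
  measurable [set w | (all_small z s e `&` bounded_off X K) (W w)].
Proof. by apply: measurable_preW; apply: measurableI => //; exact: measurable_all_small. Qed.

(** The shift of a pivot depends on the other entries, so the induction has to carry a bound on them
    as well. [X] holds the pivots of the forms already removed. *)
Let prob_all_small_bounded_ge z s X : triangular s ->
  (forall x y, x \in X -> y \in s -> y.2 x.1 x.2 = 0%R) ->
  exists c K : R, [/\ (0 < c)%R, (0 <= K)%R & forall e, (0 < e <= 1)%R ->
    (c * e ^+ size s)%:E <= P [set w | (all_small z s e `&` bounded_off X K) (W w)]].
Proof.
elim: s X => [|[x c] s IH] X.
  move=> _ _; have [c c0 cP] := @normal_prob_ball_ge R 0 (lexx 0%R).
  exists (c ^+ #|{: 'I_p * 'I_q}|)%R, 1%R; split=> //; first by rewrite exprn_gt0.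
  move=> e _; rewrite mulr1.
  have mB : measurable [set r : R | `|r + 0| <= 1]%R by rewrite set_ballE; exact: measurable_itv.
  pose A := [set w | forall x, `|W w x.1 x.2 + 0| <= 1]%R.
  have PA : P A = \prod_(x : 'I_p * 'I_q) normal_prob 0 1 [set r : R | `|r + 0| <= 1]%R.
    exact: (gaussian_entries_box gW (fun=> mB)).
  apply: (@le_trans _ _ (P A)).
    rewrite PA -prodr_const.
    have h : c%:E <= normal_prob 0 1 [set r : R | `|r + 0| <= 1]%R.
      by have H := cP 0%R 1%R; rewrite mulr1 in H; apply: H; rewrite ?normr0 // ltr01 /=.
    suff [] : (0 <= \prod_(x : 'I_p * 'I_q) c)%R /\ (\prod_(x : 'I_p * 'I_q) c)%:E <=
      \prod_(x : 'I_p * 'I_q) normal_prob 0 1 [set r : R | `|r + 0| <= 1]%R by [].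
    apply: (big_ind2 (fun (a : R) b => (0 <= a)%R /\ a%:E <= b)) => //.
      move=> a a' b b' [a0 aa'] [b0 bb']; split; first exact: mulr_ge0.
      by rewrite EFinM; apply: lee_pmul.
    by move=> x _; split; first exact: ltW.
  apply: le_measure; rewrite ?inE.
  - have := measurable_preW (measurable_bounded_off [::] 1%R).
    congr measurable; apply/seteqP; split => w /= h x; have := h x; rewrite ?addr0 //.
    by apply.
  - exact: measurable_small_bounded.
  - by move=> w /= h; split=> // y _; have := h y; rewrite addr0.
move=> [cx s0 ts] Xs.
have [||c1 [K1 [c10 K10 IH1]]] := IH (x :: X).
- by [].
- move=> x' y; rewrite inE => /predU1P[->|x'X] ys; first exact: s0.
  by apply: Xs => //; rewrite inE ys orbT.
(* Bounds the form [c] at [v + z] when [v] vanishes at [x] and is bounded by [K1] off [x :: X]: on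
   [X] the coefficients of [c] are 0. *)
pose M := (\sum_i \sum_j `|c i j| * (K1 + `|z i j|))%R.
have M0 : (0 <= M)%R by do 2 (apply: sumr_ge0 => ? _); rewrite mulr_ge0 ?addr_ge0.
have [c2 c20 c2P] := pull_entry_ge gW M0.
(* The pivot entry is within [e <= 1] of minus its shift, hence at most [1 + M] in absolute value;
   the others keep the bound [K1]. *)
exists (c2 * c1)%R, (K1 + 1 + M)%R; split; [by rewrite mulr_gt0|by rewrite !addr_ge0|].
move=> e e01; have /andP[e0 e1] := e01.
pose C := all_small z s e `&` bounded_off (x :: X) K1.
pose g v := mxdot c (v + z).
have mC : measurable C by apply: measurableI => //; exact: measurable_all_small.
have gM v : C v -> v x.1 x.2 = 0%R -> (`|g v| <= M)%R.
  move=> [_ vK] vx; rewrite /g /mxdot (le_trans (ler_norm_sum _ _ _)) //.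
  apply: ler_sum => i _; rewrite (le_trans (ler_norm_sum _ _ _)) //.
  apply: ler_sum => j _; rewrite normrM.
  have [ijX|ijX] := boolP ((i, j) \in X).
    by have := Xs (i, j) (x, c) ijX (mem_head _ _) => /= ->; rewrite normr0 !mul0r.
  rewrite ler_wpM2l // mxE (le_trans (ler_normD _ _)) // lerD2r.
  have [ijx|ijx] := eqVneq (i, j) x; last by apply: (vK (i, j)); rewrite inE negb_or ijx.
  by move: vx; rewrite -ijx /= => ->; rewrite normr0.
have CE w : C (zero_entry x (W w)) <-> C (W w).
  rewrite /C /= all_small_zero_entry //; split=> -[h1 h2]; split=> // y yX;
    have := h2 y yX; rewrite mxE -surjective_pairing ifF //;
    by apply/negbTE; move: yX; rewrite inE negb_or => /andP[].
apply: (@le_trans _ _ ((c2 * e)%:E * P [set w | C (zero_entry x (W w))])).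
  rewrite (_ : [set w | _] = [set w | C (W w)]); last by apply/seteqP; split => w /CE.
  apply: (@le_trans _ _ ((c2 * e)%:E * (c1 * e ^+ size s)%:E)).
    by rewrite -EFinM lee_fin /= exprS mulrACA.
  by apply: lee_wpmul2l; [rewrite lee_fin mulr_ge0 // ltW|exact: IH1].
have E w : (W w x.1 x.2 + g (zero_entry x (W w)) = mxdot c (W w + z))%R.
  by rewrite /g !mxdotDr (mxdot_zero_entry x c (W w)) cx mul1r addrA.
apply: (le_trans (c2P x g C e (measurable_mxdot_shift c z) mC e01 gM)).
apply: le_measure; rewrite ?inE.
- have := measurable_preW (measurableI _ _ (measurable_form_ball c z e) mC).
  congr measurable; apply/seteqP; split => w /= [h1 h2]; split;
    [by rewrite E|exact/CE|by rewrite -E|exact/CE].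
- exact: measurable_small_bounded.
move=> w /= [h1 /[dup] Cv /CE [h2 h3]].
split; first by rewrite all_small_cons; split=> //=; rewrite -E.
move=> y yX; have [->|yx] := eqVneq y x; last first.
  by rewrite (le_trans (h3 y _)) ?inE ?negb_or ?yx // -addrA lerDl addr_ge0.
have gv : (`|g (zero_entry x (W w))| <= M)%R.
  by apply: gM => //; rewrite mxE -surjective_pairing eqxx.
move: h1 gv; rewrite !ler_norml => /andP[? ?] /andP[? ?]; apply/andP; split; lra.
Qed.

Lemma prob_all_small_ge z s : triangular s ->
  exists2 c : R, (0 < c)%R & forall e, (0 < e <= 1)%R ->
    (c * e ^+ size s)%:E <= P [set w | all_small z s e (W w)].
Proof.
move=> ts; have [|c [K [c0 K0 cP]]] := @prob_all_small_bounded_ge z s [::] ts.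
  by move=> x y; rewrite in_nil.
exists c => // e e01; rewrite (le_trans (cP e e01)) //.
apply: le_measure; rewrite ?inE.
- exact: measurable_small_bounded.
- by apply: measurable_preW; exact: measurable_all_small.
- by move=> w [].
Qed.

End triangular_systems.

(** * Pivoting in a space of linear forms *)

Section triangular_existence.
Context (R : realType) (p q : nat).

Definition mx_coord (x : 'I_p * 'I_q) (M : 'M[R]_(p, q)) : R^o := M x.1 x.2.

Fact mx_coord_is_linear x : linear (mx_coord x).
Proof. by move=> a M N; rewrite /mx_coord !mxE. Qed.

HB.instance Definition _ x := GRing.isLinear.Build R 'M[R]_(p, q) R^o _
  (mx_coord x) (mx_coord_is_linear x).

(* Satisfied by the linear combinations [v] of the forms of [s]. *)
Definition controlled (s : seq (('I_p * 'I_q) * 'M[R]_(p, q))) (v : 'M[R]_(p, q)) :=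
  exists2 K : R, 0 <= K & forall (M : 'M[R]_(p, q)) e, 0 <= e ->
    (forall y, y \in s -> `|mxdot y.2 M| <= e) -> `|mxdot v M| <= K * e.

(** Gaussian elimination: a nonzero form is divided by its entry of largest modulus, which bounds
    its coefficients by 1, and the forms of [V] vanishing at that position make a subspace of
    codimension 1. *)
Lemma triangular_exists k (V : {vspace 'M[R]_(p, q)}) : (k <= \dim V)%N ->
  exists s, [/\ size s = k, triangular s,
    forall y, y \in s -> y.2 \in V /\ forall i j, `|y.2 i j| <= 1 &
    k = \dim V -> forall v, v \in V -> controlled s v].
Proof.
elim: k V => [|k IH] V kV.
  exists [::]; split=> // /esym/eqP; rewrite dimv_eq0 => /eqP -> v.
  rewrite memv0 => /eqP ->; exists 0 => // M e e0 _.
  by rewrite mxdotE trmx0 mul0mx linear0 normr0 mul0r.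
have V0 : V != 0%VS by rewrite -dimv_eq0 -lt0n (leq_ltn_trans _ kV).
set v := vpick V; have v0 : v != 0 by rewrite vpick0.
have vV : v \in V by exact: memv_pick.
have [x0 vx0] : exists x : 'I_p * 'I_q, v x.1 x.2 != 0.
  apply/not_existsP => h; move/eqP: v0; apply; apply/matrixP => i j.
  by rewrite mxE; apply/eqP/negP => /negP ?; exact: (h (i, j)).
pose x := [arg max_(x > x0) `|v x.1 x.2|]%O.
have xmax y : `|v y.1 y.2| <= `|v x.1 x.2|.
  by rewrite /x; case: arg_maxP => // ? _; apply.
have vx : v x.1 x.2 != 0.
  by rewrite -normr_gt0 (lt_le_trans _ (xmax x0)) // normr_gt0.
pose c := (v x.1 x.2)^-1 *: v.
have cx : c x.1 x.2 = 1 by rewrite mxE mulVf.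
have cV : c \in V by rewrite memvZ.
pose f := linfun (mx_coord x).
pose V' := (V :&: lker f)%VS.
have V'E u : (u \in V') = (u \in V) && (u x.1 x.2 == 0).
  by rewrite memv_cap memv_ker lfunE.
have dimV' : \dim V = (\dim V').+1.
  have dV := limg_ker_dim f V.
  apply/eqP; rewrite eqn_leq; apply/andP; split.
    rewrite -dV -/V' -addn1 leq_add2l (leq_trans (dimvS (subvf _))) //.
    by rewrite dimvf.
  rewrite ltn_neqAle dimvS ?capvSl // andbT; apply/negP => /eqP dE.
  have : (V' == V) by rewrite eqEdim capvSl dE leqnn.
  by move=> /eqP VE; move: cV; rewrite -VE V'E cx oner_eq0 andbF.
have [|s [ss ts sV ctl]] := IH V'; first by rewrite -ltnS -dimV'.
exists ((x, c) :: s); split.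
- by rewrite /= ss.
- by split=> // y /sV[]; rewrite V'E => /andP[_ /eqP].
- move=> y; rewrite inE => /predU1P[->|/sV[]]; last first.
    by rewrite V'E => /andP[].
  split=> // i j; rewrite mxE normrM normrV ?unitfE // mulrC ler_pdivrMr ?normr_gt0 //.
  by rewrite mul1r; exact: (xmax (i, j)).
- rewrite dimV' => -[kE] u uV.
  have u'V : u - u x.1 x.2 *: c \in V'.
    rewrite V'E memvB ?memvZ // !mxE; apply/eqP.
    by rewrite mulVf // mulr1 subrr.
  have [K K0 KP] := ctl kE _ u'V.
  exists (K + `|u x.1 x.2|) => [|M e e0 h]; first by rewrite addr_ge0.
  have -> : mxdot u M = mxdot (u - u x.1 x.2 *: c) M + u x.1 x.2 * mxdot c M.
    by rewrite -mxdotZl -mxdotDl subrK.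
  rewrite (le_trans (ler_normD _ _)) // mulrDl lerD //.
    by apply: KP => // y ys; apply: h; rewrite inE ys orbT.
  by rewrite normrM ler_wpM2l //; apply: (h (x, c)); rewrite mem_head.
Qed.

End triangular_existence.

(** * The quadratic form tr(X' S^+ X) *)

Section loss_algebra.
Context (R : realType).

Definition loss (l p q : nat) (y : 'M[R]_(l, p)) (x : 'M[R]_(p, q)) : R :=
  \tr (x^T *m mpinv (y^T *m y) *m x).

Lemma mpinv_sym k (A : 'M[R]_k) : A^T = A -> (mpinv A)^T = mpinv A.
Proof.
move=> sA; have [ABA BAB sAB sBA] := mpinvP A.
apply: (@is_mpinv_uniq _ _ _ A); last exact: mpinvP.
move: (mpinv A) => B in ABA BAB sAB sBA *.
have e1 : A *m B^T = B *m A by rewrite -{1}sA -trmx_mul sBA.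
have e2 : B^T *m A = A *m B by rewrite -{1}sA -trmx_mul sAB.
split.
- by rewrite -[RHS]sA -[in RHS]ABA !trmx_mul sA mulmxA.
- by rewrite -[in RHS]BAB !trmx_mul sA mulmxA.
- by rewrite e1.
- by rewrite e2.
Qed.

Context (l p q : nat) (y : 'M[R]_(l, p)).
Local Notation s := (y^T *m y).
Local Notation sp := (mpinv s).

Let s_sym : s^T = s. Proof. by rewrite trmx_mul trmxK. Qed.

Let s_comm : s *m sp = sp *m s.
Proof.
have [_ _ sAB _] := mpinvP s.
by rewrite -sAB trmx_mul mpinv_sym ?s_sym.
Qed.

Lemma lossE (x : 'M[R]_(p, q)) : loss y x = mxdot (y *m sp *m x) (y *m sp *m x).
Proof.
have [_ BAB _ _] := mpinvP s.
rewrite /loss mxdotE -{1}BAB !trmx_mul mpinv_sym ?s_sym //.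
by rewrite !mulmxA.
Qed.

Lemma loss_ge0 (x : 'M[R]_(p, q)) : 0 <= loss y x.
Proof. by rewrite lossE mxdot_ge0. Qed.

(** Since [s s^+ s = s], one has [<s D, x> = <y s D, y s^+ x>], and Cauchy-Schwarz applies. Here
    [mxdot y y] is the trace of [s]. *)
Lemma mxdot_sqr_le_loss (D x : 'M[R]_(p, q)) :
  mxdot (s *m D) x ^+ 2 <= mxdot y y * mxdot (s *m D) (s *m D) * loss y x.
Proof.
have [ABA _ sAB _] := mpinvP s.
have -> : mxdot (s *m D) x = mxdot (y *m (s *m D)) (y *m sp *m x).
  rewrite [RHS]mxdot_mull -(mulmxA y sp) (mulmxA y^T) (mulmxA s sp) [RHS]mxdotC.
  by rewrite [RHS]mxdot_mull sAB (mulmxA (s *m sp)) ABA mxdotC.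
apply: (le_trans (mxdot_CS _ _)); rewrite -lossE.
by rewrite ler_wpM2r ?loss_ge0 // mxdot_mulmx_le.
Qed.

(** As [s] commutes with [s^+], [s^+ x = s^+ s^+ (s x)]. *)
Lemma loss_le (x : 'M[R]_(p, q)) :
  loss y x <= mxdot (y *m sp *m sp) (y *m sp *m sp) * mxdot (s *m x) (s *m x).
Proof.
have [_ BAB _ _] := mpinvP s.
have E : y *m sp *m x = y *m sp *m sp *m (s *m x).
  rewrite (mulmxA _ s x) -(mulmxA (y *m sp) sp s) -s_comm (mulmxA (y *m sp) s sp).
  by rewrite -(mulmxA y sp s) -(mulmxA y _ sp) BAB.
by rewrite lossE E mxdot_mulmx_le.
Qed.

Lemma measurable_loss d (T : measurableType d) (X : T -> 'M[R]_(p, q)) :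
  measurable_fun setT X -> measurable_fun setT (fun w => loss y (X w)).
Proof.
move=> mX; apply: measurable_mxtrace; apply: measurable_mulmx => //.
by apply: measurable_mulmx; [exact: measurable_trmx|exact: measurable_cst].
Qed.

End loss_algebra.

(** * Columnwise transformations and their adjoints *)

Section column_transform.
Context (R : realType) (p q : nat) (A : 'I_q -> 'M[R]_p).

(** The matrix varies with the column because [normal_vector] supplies a separate factor of the
    covariance for each one. *)
Definition col_mul (M : 'M[R]_(p, q)) : 'M[R]_(p, q) :=
  \matrix_(i, j) (A j *m col j M) i 0.

Lemma col_col_mul j M : col j (col_mul M) = A j *m col j M.
Proof. by apply/matrixP => i k; rewrite !mxE ord1. Qed.

End column_transform.

Section adjoint_transform.
Context (R : realType) (p q : nat) (A : 'I_q -> 'M[R]_p).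
Context (A_unit : forall j, A j \in unitmx).
Local Notation adj := (col_mul (fun j => (A j)^T)).

Fact col_mul_is_linear (B : 'I_q -> 'M[R]_p) : linear (col_mul B).
Proof.
move=> a M N; apply/matrixP => i j; rewrite !mxE mulr_sumr -big_split.
by apply: eq_bigr => k _; rewrite !mxE mulrDr mulrCA.
Qed.

HB.instance Definition _ B := GRing.isLinear.Build R 'M[R]_(p, q) 'M[R]_(p, q) _
  (col_mul B) (col_mul_is_linear B).

Lemma mxdot_cols (M N : 'M[R]_(p, q)) : mxdot M N = \sum_j mxdot (col j M) (col j N).
Proof.
rewrite /mxdot exchange_big; apply: eq_bigr => j _.
by apply: eq_bigr => i _; rewrite big_ord1 !mxE.
Qed.

Lemma mxdot_col_mul C M : mxdot C (col_mul A M) = mxdot (adj C) M.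
Proof.
rewrite !mxdot_cols; apply: eq_bigr => j _.
by rewrite !col_col_mul mxdot_mull trmxK.
Qed.

Lemma mxdot_adj_ge : exists2 B : R, 0 <= B & forall C : 'M[R]_(p, q),
  mxdot C C <= B * mxdot (adj C) (adj C).
Proof.
exists (\sum_j mxdot (invmx (A j)^T) (invmx (A j)^T)).
  by apply: sumr_ge0 => j _; exact: mxdot_ge0.
move=> C; rewrite mulr_suml mxdot_cols; apply: ler_sum => j _.
have -> : col j C = invmx (A j)^T *m col j (adj C).
  by rewrite col_col_mul mulKmx // unitmx_tr.
apply: (le_trans (mxdot_mulmx_le _ _)); apply: ler_wpM2l; first exact: mxdot_ge0.
rewrite (mxdot_cols (adj C)) (bigD1 j) //= lerDl.
by apply: sumr_ge0 => i _; exact: mxdot_ge0.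
Qed.

Lemma adj_inj : injective adj.
Proof.
move=> C D CD; apply/matrixP => i j.
have /(congr1 (fun M => invmx (A j)^T *m M)) : col j (adj C) = col j (adj D) by rewrite CD.
by rewrite !col_col_mul !mulKmx ?unitmx_tr // => /colP /(_ i); rewrite !mxE.
Qed.

(* [V] consists of the forms <s D, X>, written as forms in the Gaussian entries. *)
Lemma form_space (s : 'M[R]_p) : exists V : {vspace 'M[R]_(p, q)},
  [/\ \dim V = (q * \rank s)%N, forall D, adj (s *m D) \in V &
      forall c, c \in V -> exists D, c = adj (s *m D)].
Proof.
pose B := col_base s.
pose g (D : 'M[R]_(\rank s, q)) := adj (B *m D).
have g_lin : linear g by move=> a M N; rewrite /g mulmxDr -scalemxAr linearP.
pose gL : {linear 'M[R]_(\rank s, q) -> 'M[R]_(p, q)} :=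
  HB.pack g (GRing.isLinear.Build _ _ _ _ g g_lin).
exists (limg (linfun gL)); split.
- rewrite limg_dim_eq ?dimvf.
    by rewrite mulnC.
  apply/eqP; rewrite capfv -subv0; apply/subvP => D.
  rewrite memv_ker lfunE /= => /eqP gD0.
  rewrite memv0; apply/eqP.
  have BD : B *m D = 0.
    by apply: adj_inj; rewrite linear0; exact: gD0.
  by apply: (row_full_inj (col_base_full s)); rewrite mulmx0.
- move=> D; have -> : adj (s *m D) = linfun gL (row_base s *m D).
    by rewrite lfunE /= /g mulmxA mulmx_base.
  by rewrite memv_img ?memvf.
- move=> c /memv_imgP[D _ ->]; exists (pinvmx (row_base s) *m D).
  rewrite lfunE /= /g mulmxA; congr (adj (_ *m _)).
  have : col_base s *m row_base s *m pinvmx (row_base s) = col_base s.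
    by rewrite -mulmxA mulmxVp ?mulmx1 // row_base_free.
  by rewrite mulmx_base.
Qed.

End adjoint_transform.

Lemma dyadic_sqr (R : realType) n : (2 ^- n) ^+ 2 = 4 ^- n :> R.
Proof. by rewrite exprVn exprAC -natrX. Qed.

Lemma dyadic_cube (R : realType) n : (2 ^- n) ^+ 3 = 8 ^- n :> R.
Proof. by rewrite exprVn exprAC -natrX. Qed.

(** * The conditional expectation of the inverse loss *)

Section conditional_integrals.
Context d (T : measurableType d) (R : realType) (P : probability T R) (p q : nat).
Context (A : 'I_q -> 'M[R]_p) (A_unit : forall j, A j \in unitmx).
Context (W : T -> 'M[R]_(p, q)) (gW : gaussian_entries P W) (z : 'M[R]_(p, q)).
Local Notation X := (fun w => col_mul A (W w + z)).
Local Notation adj := (col_mul (fun j => (A j)^T)).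

Let mX : measurable_fun setT X.
Proof.
have mW : measurable_fun setT W by case: gW.
apply/measurable_mxP => i j; under eq_fun do rewrite !mxE.
apply: measurable_sum => k; apply: measurable_funM => //.
under eq_fun do rewrite !mxE.
by apply: measurable_funD => //; move: k j; apply/measurable_mxP.
Qed.

Let mloss l (y : 'M[R]_(l, p)) : measurable_fun setT (fun w => loss y (X w)).
Proof. exact: measurable_loss. Qed.

Lemma integral_inv_loss_le : exists2 K : R, 0 <= K &
  forall l (y : 'M[R]_(l, p)), (2 < q * \rank (y^T *m y))%N ->
  (\int[P]_w ((loss y (X w))^-1)%:E <= (K * mxdot y y)%:E)%E.
Proof.
have [B B0 BP] := mxdot_adj_ge A_unit.
(* Coefficients at most 1 give [|adj (s D)|^2 <= p q], so [|s D|^2 <= B p q]; adding 1 makes [b]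
   positive. *)
pose b := B * (p * q)%:R + 1.
have b0 : 0 < b by rewrite ltr_wpDl // mulr_ge0.
pose C : R := (2 * normal_peak 1) ^+ 3.
have C0 : 0 <= C by rewrite exprn_ge0 // mulr_ge0 // normal_peak_ge0.
exists ((1 + 8 * C) * b).
  by apply: mulr_ge0; [rewrite addr_ge0 // mulr_ge0|exact: ltW].
move=> l y rk.
have [V [dimV VP1 VP2]] := form_space A_unit (y^T *m y).
(* Three forms suffice whatever the rank: they give the cube [8^-k] and a constant free of [y]. *)
have [s [ss ts sV _]] : exists s, [/\ size s = 3, triangular s,
    forall c, c \in s -> c.2 \in V /\ forall i j, `|c.2 i j| <= 1 & 3%N = \dim V ->
    forall v, v \in V -> controlled s v] by apply: triangular_exists; rewrite dimV.
have y0 : 0 < mxdot y y.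
  rewrite lt_def mxdot_ge0 mxdot_eq0 andbT; apply/eqP => y0.
  by move: rk; rewrite y0 mulmx0 mxrank0 muln0.
have formP c w : c \in s -> mxdot c.2 (W w + z) ^+ 2 <= b * mxdot y y * loss y (X w).
  move=> cs; have [cV c1] := sV c cs; have [D cD] := VP2 _ cV.
  have := mxdot_sqr_le_loss y D (X w).
  rewrite mxdot_col_mul -cD => /le_trans; apply.
  rewrite ler_wpM2r ?loss_ge0 // mulrC ler_wpM2r ?mxdot_ge0 //.
  apply: (le_trans (BP _)); rewrite -cD ler_wpDr // ler_wpM2l //.
  rewrite natrM mulr_natl -[X in X *+ p]mulr_natl.
  have -> : q%:R * 1 *+ p = \sum_(i < p) \sum_(j < q) (1 : R).
    by rewrite !sumr_const !card_ord mulr1.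
  apply: ler_sum => i _; apply: ler_sum => j _.
  by have := c1 i j; rewrite -expr2 -real_normK ?num_real // => h; rewrite expr_le1.
pose f w := b * mxdot y y * loss y (X w).
have by0 : 0 < b * mxdot y y by rewrite mulr_gt0.
have mf : measurable_fun setT f by exact: measurable_funM.
have f0 w : 0 <= f w by rewrite mulr_ge0 ?loss_ge0 // ltW.
have fP k : (P [set w | f w <= 4 ^- k]%R <= (C * 8 ^- k)%:E)%E.
  have e0 : 0 <= 2 ^- k :> R by rewrite invr_ge0 exprn_ge0.
  apply: (@le_trans _ _ (P [set w | all_small z s (2 ^- k) (W w)])).
    apply: le_measure; rewrite ?inE.
    - exact: measurable_le_set.
    - have mW : measurable_fun setT W by case: gW.
      by have := mW measurableT _ (measurable_all_small z s (2 ^- k)); rewrite setTI.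
    move=> w /= fw c cs; rewrite -ler_sqr ?nnegrE // real_normK ?num_real //.
    apply: (le_trans (formP c w cs)); apply: (le_trans fw).
    by rewrite dyadic_sqr.
  apply: (le_trans (prob_all_small_le gW z ts e0)).
  rewrite ss lee_fin exprMn -/C ler_wpM2l //.
  by rewrite dyadic_cube.
have H := integral_inv_le mf f0 C0 fP.
have -> : (fun w => ((loss y (X w))^-1)%:E) =
    (fun w => (b * mxdot y y)%:E * ((f w)^-1)%:E)%E.
  by apply/funext => w; rewrite -EFinM /f invfM mulrA mulfV ?mul1r // gt_eqF.
rewrite ge0_integralZl_EFin //.
- apply: (@le_trans _ _ ((b * mxdot y y)%:E * (1 + 8 * C)%:E)%E).
    by apply: lee_wpmul2l => //; rewrite lee_fin ltW.
  by rewrite -EFinM lee_fin mulrC mulrA.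
- by move=> w _; rewrite lee_fin invr_ge0.
- by apply/measurable_EFinP; exact: measurable_funV.
- exact: ltW.
Qed.

Lemma integral_inv_loss_infty l (y : 'M[R]_(l, p)) :
  (0 < q * \rank (y^T *m y) <= 2)%N ->
  (\int[P]_w ((loss y (X w))^-1)%:E = +oo)%E.
Proof.
set s := y^T *m y; move=> /andP[rk0 rk2].
have mW : measurable_fun setT W by case: gW.
have [V [dimV VP1 VP2]] := form_space A_unit s.
have mAS t e : measurable [set w | all_small z t e (W w)].
  by have := mW measurableT _ (measurable_all_small z t e); rewrite setTI.
(* A vanishing loss forces every form of [V] to vanish, and one form alone is at most [e'] with
   probability at most [e]. *)
have loss0 : P [set w | loss y (X w) = 0] = 0%E.
  have [t [st tt tV _]] := @triangular_exists R p q 1 V ltac:(by rewrite dimV).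
  have mL0 : measurable [set w | loss y (X w) = 0].
    by have := mloss y measurableT (measurable_set1 0); rewrite setTI.
  apply/eqP; rewrite eq_le measure_ge0 andbT.
  apply/lee_addgt0Pr => e e0; rewrite add0e.
  have pk0 : 0 < 2 * normal_peak 1 :> R by rewrite mulr_gt0 // normal_peak_gt0 // oner_neq0.
  pose e' := e / (2 * normal_peak 1).
  have e'0 : 0 <= e' by rewrite divr_ge0 // ltW.
  apply: (@le_trans _ _ (P [set w | all_small z t e' (W w)])).
    apply: le_measure; rewrite ?inE // => w /= L0 c ct.
    have [cV _] := tV c ct; have [D cD] := VP2 _ cV.
    have := mxdot_sqr_le_loss y D (X w).
    rewrite mxdot_col_mul -cD L0 mulr0 => h.
    have /eqP : mxdot c.2 (W w + z) ^+ 2 = 0 by apply/eqP; rewrite eq_le h sqr_ge0.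
    by rewrite sqrf_eq0 => /eqP ->; rewrite normr0.
  apply: (le_trans (prob_all_small_le gW z tt e'0)).
  by rewrite st expr1 /e' mulrCA mulfV ?mulr1 // gt_eqF.
have [t [st tt tV ctl]] := @triangular_exists R p q _ V (leqnn _).
(* The entries of [s X] as forms in [V]. A triangular system of full length controls them all, hence
   the loss through [loss_le]. *)
pose v (x : 'I_p * 'I_q) := adj (s *m delta_mx x.1 x.2).
have vE x w : (s *m X w) x.1 x.2 = mxdot (v x) (W w + z).
  rewrite -mxdot_col_mul mxdot_mull trmx_mul trmxK.
  rewrite /mxdot (bigD1 x.1) //= (bigD1 x.2) //= !mxE !eqxx mul1r.
  rewrite [X in _ + X + _]big1 ?[X in _ + _ + X]big1 ?addr0 //.
    move=> i /negbTE ix; apply: big1 => j _; by rewrite !mxE ix mul0r.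
  by move=> j /negbTE jx; rewrite !mxE jx andbF mul0r.
have ctlv x : controlled t (v x) by apply: ctl => //; exact: VP1.
pose K x := sval (cid2 (ctlv x)).
have K0 x : 0 <= K x by rewrite /K; case: cid2.
have KP x M e : 0 <= e -> (forall c, c \in t -> `|mxdot c.2 M| <= e) ->
    `|mxdot (v x) M| <= K x * e.
  by rewrite /K; case: cid2 => k /= _; apply.
set H := mxdot (y *m mpinv s *m mpinv s) (y *m mpinv s *m mpinv s).
pose k := H * (\sum_i \sum_j (K (i, j)) ^+ 2) + 1.
have k0 : 0 < k.
  rewrite ltr_wpDl // mulr_ge0 ?mxdot_ge0 //.
  by do 2 (apply: sumr_ge0 => ? _); rewrite sqr_ge0.
have lossP e w : 0 <= e -> all_small z t e (W w) -> loss y (X w) <= k * e ^+ 2.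
  move=> e0 sm; apply: (le_trans (loss_le _ _)); rewrite -/H -/s.
  apply: (@le_trans _ _ (H * (\sum_i \sum_j (K (i, j)) ^+ 2) * e ^+ 2)); last first.
    by rewrite ler_wpM2r ?sqr_ge0 // lerDl.
  rewrite -mulrA ler_wpM2l ?mxdot_ge0 // mulr_suml; apply: ler_sum => i _.
  rewrite mulr_suml; apply: ler_sum => j _; rewrite (vE (i, j)) -expr2 -exprMn.
  rewrite -real_normK ?num_real // lerXn2r ?nnegrE ?mulr_ge0 //.
  exact: KP.
have [c c0 cP] := prob_all_small_ge gW z tt.
pose f w := loss y (X w) / k.
have mf : measurable_fun setT f by exact: measurable_funM.
have f0 w : 0 <= f w by rewrite divr_ge0 ?loss_ge0 // ltW.
have : (\int[P]_w ((f w)^-1)%:E = +oo)%E.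
  apply: (integral_inv_infty mf f0 c0).
    rewrite -loss0; congr (P _); apply/seteqP; split => w /=; last first.
      by rewrite /f => ->; rewrite mul0r.
    by move/eqP; rewrite /f mulf_eq0 invr_eq0 (gt_eqF k0) orbF => /eqP.
  move=> n; have e01 : 0 < (2 ^- n : R) <= 1.
    by rewrite invr_gt0 exprn_gt0 //= invf_le1 ?exprn_gt0 // exprn_ege1 // ler1n.
  have /andP[e0 e1] := e01.
  apply: (@le_trans _ _ (P [set w | all_small z t (2 ^- n) (W w)])).
    (* Here the bound on the rank enters: for [e <= 1], [e^m >= e^2] as soon as [m <= 2]. *)
    apply: le_trans (cP _ e01); rewrite lee_fin ler_pM2l // st dimV.
    rewrite -dyadic_sqr.
    by apply: ler_wiXn2l => //; exact: ltW.
  apply: le_measure; rewrite ?inE //.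
    exact: measurable_le_set.
  move=> w /= /(lossP _ _ (ltW e0)) h; rewrite /f ler_pdivrMr // (le_trans h) // mulrC.
  by rewrite dyadic_sqr.
have -> : (fun w => ((f w)^-1)%:E) = (fun w => k%:E * ((loss y (X w))^-1)%:E)%E.
  by apply/funext => w; rewrite -EFinM /f invfM invrK mulrC.
rewrite ge0_integralZl_EFin //.
- have : (0 <= \int[P]_w ((loss y (X w))^-1)%:E)%E.
    by apply: integral_ge0 => w _; rewrite lee_fin invr_ge0 loss_ge0.
  by case: (\int[P]_w _)%E => [r| |].
- by move=> w _; rewrite lee_fin invr_ge0 loss_ge0.
- by apply/measurable_EFinP; apply: measurable_funV.
- exact: ltW.
Qed.

End conditional_integrals.

(** * Normal columns and rows *)

Section normal_models.
Context d (T : measurableType d) (R : realType) (P : probability T R).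

Lemma posdefmx_unit k (M : 'M[R]_k) : posdefmx M -> M \in unitmx.
Proof.
case=> _ pos; rewrite -row_free_unit; apply: inj_row_free => v vM0.
apply/eqP/negP => /negP v0.
have := pos v^T; rewrite trmxK vM0 mul0mx mxE ltxx => H; apply/notF/H.
by apply: contra v0 => /eqP/(congr1 trmx); rewrite trmxK trmx0 => ->.
Qed.

Lemma unitmx_factor k (A V : 'M[R]_k) : A *m A^T = V -> V \in unitmx -> A \in unitmx.
Proof. by move=> <-; rewrite unitmx_mul => /andP[]. Qed.

(** Independence is given for the columns of [X], but wanted for the standard normal vectors behind
    them. Invertibility of [A j] recovers each such vector from its column and thereby transfers
    independence. *)
Lemma normal_columns_gaussian p q (theta : 'M[R]_(p, q)) (V : 'M[R]_p)
    (X : T -> 'M[R]_(p, q)) :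
  V \in unitmx -> normal_indep_columns P theta V X ->
  exists A (W : T -> 'M[R]_(p, q)) z, [/\ forall j : 'I_q, A j \in unitmx,
    gaussian_entries P W & forall w, X w = col_mul A (W w + z)].
Proof.
move=> uV [iX nX].
pose A j := sval (cid (nX j)).
pose Z j := sval (cid (svalP (cid (nX j)))).
have AZ j : [/\ A j *m (A j)^T = V, standard_normal_vector P (Z j) &
    forall w, col j (X w) = col j theta + A j *m Z j w].
  exact: (svalP (cid (svalP (cid (nX j))))).
have uA j : A j \in unitmx by have [/unitmx_factor -> //] := AZ j.
pose W w : 'M[R]_(p, q) := \matrix_(i, j) Z j w i 0.
pose z : 'M[R]_(p, q) := \matrix_(i, j) (invmx (A j) *m col j theta) i 0.
have colW j w : col j (W w) = Z j w by apply/colP => i; rewrite !mxE.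
have colz j : col j z = invmx (A j) *m col j theta.
  by apply/colP => i; rewrite !mxE.
have ZE j w : Z j w = invmx (A j) *m (col j (X w) - col j theta).
  by have [_ _ ->] := AZ j; rewrite addrAC subrr add0r mulKmx.
exists A, W, z; split=> //; last first.
  move=> w; apply/matrixP => i j.
  have : col j (X w) = col j (col_mul A (W w + z)).
    have [_ _ ->] := AZ j.
    by rewrite col_col_mul linearD /= colW colz mulmxDr mulKVmx // addrC.
  by move/colP/(_ i); rewrite !mxE.
split.
- apply/measurable_mxP => i j; under eq_fun do rewrite mxE.
  have [_ [mZ _ _] _] := AZ j; move/measurable_mxP : mZ; apply.
- move=> i j B mB; have [_ [_ lawZ _] _] := AZ j; rewrite -(lawZ i B mB).
  by congr (P _); apply/seteqP; split => w /=; rewrite mxE.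
- move=> B mB.
  (* The constraints on column [j] of [W], rewritten as an event about column [j] of [X]. *)
  pose D j : set 'cV[R]_p :=
    [set u | forall i, B (i, j) ((invmx (A j) *m (u - col j theta)) i 0)].
  have mD j : measurable (D j).
    have -> : D j = \bigcap_(i in [set: 'I_p])
        (fun u : 'cV[R]_p => (invmx (A j) *m (u - col j theta)) i 0) @^-1` B (i, j).
      by apply/seteqP; split => u /= h i; [move=> _|]; exact: h.
    apply: fin_bigcap_measurable => // i _; rewrite -[Y in measurable Y]setTI.
    suff : measurable_fun setT (fun u : 'cV[R]_p => (invmx (A j) *m (u - col j theta)) i 0).
      by move=> /(_ measurableT _ (mB (i, j))).
    under eq_fun do rewrite mxE.
    apply: measurable_sum => k; apply: measurable_funM => //.
    under eq_fun do rewrite mxE.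
    by apply: measurable_funD => //; exact: measurable_mx_entry.
  have DE j : (fun w => col j (X w)) @^-1` D j =
      \bigcap_i ((fun w => Z j w i 0) @^-1` B (i, j)).
    by apply/seteqP; split => w /= h i; [move=> _|]; have := h i; rewrite /= -ZE; apply.
  have -> : \bigcap_x ((fun w => W w x.1 x.2) @^-1` B x) =
      \bigcap_j ((fun w => col j (X w)) @^-1` D j).
    apply/seteqP; split => w /= h.
      move=> j _; rewrite DE => i _ /=.
      by have := h (i, j) I; rewrite /= mxE.
    move=> [i j] _ /=; rewrite mxE; have := h j I; rewrite DE => /(_ i I).
    exact.
  rewrite (iX D mD).
  rewrite [RHS](eq_bigr (fun x =>
    P ((fun w => W w x.1 x.2) @^-1` B (x.1, x.2)))); last by case.
  rewrite -(pair_bigA _ (fun i j => P ((fun w => W w i j) @^-1` B (i, j)))) /=.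
  rewrite exchange_big /=; apply: eq_bigr => j _.
  rewrite DE; have [_ [_ _ iZ] _] := AZ j.
  rewrite (iZ (fun i => B (i, j)) (fun i => mB (i, j))).
  by apply: eq_bigr => i _; congr (P _); apply/seteqP; split => w /=; rewrite mxE.
Qed.

Local Open Scope ereal_scope.

Lemma normal_prob_set1 (r : R) : normal_prob 0 1 [set r] = 0.
Proof.
apply/eqP; rewrite eq_le measure_ge0 andbT.
have := @normal_prob_ball_le R (- r) 0 (lexx _); rewrite mulr0.
rewrite (_ : [set x | _] = [set r]) //; apply/seteqP; split => x /=.
  by rewrite normr_le0 subr_eq0 => /eqP.
by move=> ->; rewrite subrr normr0.
Qed.

(* E Z^2 is E 1/f for f = 1/Z^2, whose small values are the tails of Z. *)
Lemma integral_normal_sqr (Z : T -> R) : measurable_fun setT Z ->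
  (forall B, measurable B -> P [set w | B (Z w)] = normal_prob 0 1 B) ->
  \int[P]_w ((Z w) ^+ 2)%:E < +oo.
Proof.
move=> mZ lawZ; have [C C0 CP] := normal_prob_tail_le R.
pose f w := ((Z w) ^+ 2)^-1%R.
have mf : measurable_fun setT f by apply: measurable_funV; exact: measurable_funX.
have f0 w : (0 <= f w)%R by rewrite invr_ge0 sqr_ge0.
have fP k : P [set w | f w <= 4 ^- k]%R <= (C * 8 ^- k)%:E.
  have mT : measurable [set x : R | 2 ^+ k <= `|x|]%R.
    rewrite -[X in measurable X]setTI.
    exact: (measurable_fun_ler (measurable_cst _) (@normr_measurable R setT)).
  have k0 : (0 < 2 ^+ k :> R)%R by rewrite exprn_gt0.
  (* [f] is also 0 where [Z = 0], because [0^-1 = 0]; this null event joins the tail. *)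
  have : P [set w | [set 0%R] (Z w) \/ [set x : R | 2 ^+ k <= `|x|]%R (Z w)] <=
      (C * 8 ^- k)%:E.
    have m0 := measurable_set1 (0%R : R).
    rewrite (lawZ _ (measurableU _ _ m0 mT)).
    apply: (@le_trans _ _ (normal_prob 0 1 [set 0%R] +
        normal_prob 0 1 [set x : R | 2 ^+ k <= `|x|]%R)).
      exact: (@measureU2 _ _ _ (normal_prob 0%R 1%R)).
    rewrite normal_prob_set1 add0e (le_trans (CP _ k0)) // lee_fin exprAC -natrX.
    exact: lexx.
  apply: le_trans; apply: le_measure; rewrite ?inE.
  - exact: measurable_le_set.
  - have := mZ measurableT _ (measurableU _ _ (measurable_set1 (0%R : R)) mT).
    by rewrite setTI.
  - move=> w /=; rewrite /f => fw; have [->|Z0] := eqVneq (Z w) 0%R; [by left|right].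
    have Z2 : (0 < Z w ^+ 2)%R by rewrite exprn_even_gt0.
    have k4 : (0 < 4 ^+ k :> R)%R by rewrite exprn_gt0.
    move: fw; rewrite lef_pV2 ?posrE //.
    have -> : (4 ^+ k = (2 ^+ k) ^+ 2 :> R)%R by rewrite exprAC -(natrX _ 2 2).
    rewrite -(real_normK (num_real (Z w))) ler_sqr ?nnegrE // ltW.
apply: (@le_lt_trans _ _ (\int[P]_w ((f w)^-1)%:E)).
  rewrite le_eqVlt; apply/orP; left; apply/eqP.
  by apply: eq_integral => w _; rewrite /f invrK.
exact: le_lt_trans (integral_inv_le mf f0 C0 fP) (ltry _).
Qed.

Lemma normal_rows_integral l p (V : 'M[R]_p) (Y : T -> 'M[R]_(l, p)) :
  measurable_fun setT Y -> normal_indep_rows P 0 V Y ->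
  \int[P]_w (mxdot (Y w) (Y w))%:E < +oo.
Proof.
move=> /measurable_mxP mY [_ nY].
rewrite /mxdot; under eq_integral => w _ do rewrite -sumEFin.
rewrite ge0_integral_sum //; last 2 first.
- move=> i; apply/measurable_EFinP; apply: measurable_sum => j.
  exact: measurable_funM.
- by move=> i w _; rewrite lee_fin; apply: sumr_ge0 => j _; rewrite -expr2 sqr_ge0.
apply: lte_sum_pinfty => i _.
under eq_integral => w _ do rewrite -sumEFin.
rewrite ge0_integral_sum //; last 2 first.
- by move=> j; apply/measurable_EFinP; exact: measurable_funM.
- by move=> j w _; rewrite lee_fin -expr2 sqr_ge0.
apply: lte_sum_pinfty => j _.
have [A [Z [_ [/measurable_mxP mZ lawZ _] YZ]]] := nY i.
apply: (@le_lt_trans _ _ (\int[P]_w (\sum_k (mxdot A A)%:E * (Z w k 0%R ^+ 2)%:E))).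
  apply: ge0_le_integral => //.
  - by move=> w _; rewrite lee_fin -expr2 sqr_ge0.
  - by apply/measurable_EFinP; exact: measurable_funM.
  - apply: emeasurable_sum => k; apply: emeasurable_funM; first exact: measurable_cst.
    by apply/measurable_EFinP; exact: measurable_funX.
  - move=> w _; rewrite (eq_bigr (fun k => (mxdot A A * Z w k 0 ^+ 2)%:E)) // sumEFin lee_fin.
    have -> : (Y w i j = (A *m Z w) j 0)%R.
      by have /colP /(_ j) := YZ w; rewrite row0 trmx0 add0r !mxE.
    rewrite -mulr_sumr -expr2 (le_trans (mxdot_entry _ _ _)) //.
    rewrite (le_trans (mxdot_mulmx_le _ _)) // ler_wpM2l ?mxdot_ge0 //.
    by rewrite /mxdot; apply: ler_sum => k _; rewrite big_ord1 -expr2.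
rewrite ge0_integral_sum //; last 2 first.
- move=> k; apply: emeasurable_funM; first exact: measurable_cst.
  by apply/measurable_EFinP; exact: measurable_funX.
- by move=> k w _; rewrite -EFinM lee_fin mulr_ge0 ?mxdot_ge0 ?sqr_ge0.
apply: lte_sum_pinfty => k _; rewrite ge0_integralZl_EFin ?mxdot_ge0 //.
- apply: lte_mul_pinfty; rewrite ?lee_fin ?mxdot_ge0 //.
  by apply: integral_normal_sqr => //; exact: lawZ.
- by move=> w _; rewrite lee_fin sqr_ge0.
- by apply/measurable_EFinP; exact: measurable_funX.
Qed.

(** If the first row is 0, invertibility of its factor makes a standard normal variable vanish. *)
Lemma normal_rows_neq0 l p (V : 'M[R]_p) (Y : T -> 'M[R]_(l, p)) :
  (0 < l)%N -> (0 < p)%N -> V \in unitmx -> normal_indep_rows P 0 V Y ->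
  {ae P, forall w, Y w != 0%R}.
Proof.
move=> l0 p0 uV [_ nY]; pose i0 := Ordinal l0; pose j0 := Ordinal p0.
have [A [Z [AV [/measurable_mxP mZ lawZ _] YZ]]] := nY i0.
exists [set w | [set 0%R] (Z w j0 0%R)]; split.
- by have := mZ j0 0%R measurableT _ (measurable_set1 0%R); rewrite setTI.
- by rewrite lawZ ?normal_prob_set1.
- move=> w /= /negP; rewrite negbK => /eqP Y0.
  have := YZ w; rewrite Y0 !row0 trmx0 add0r => /(congr1 (mulmx (invmx A))).
  by rewrite mulKmx ?(unitmx_factor AV) // mulmx0 => <-; rewrite mxE.
Qed.

End normal_models.

(** * The equivalence, by conditioning on [S] *)

Theorem lemma3p2 (R : realType) (d : measure_display) (T : measurableType d)
    (P : probability T R) (n p q : nat)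
    (n_gt0 : (0 < n)%N) (p_gt0 : (0 < p)%N) (q_gt0 : (0 < q)%N)
    (theta : 'M[R]_(p, q)) (Sigma : 'M[R]_p) (Sigma_posdef : posdefmx Sigma)
    (X : {RV P >-> 'M[R]_(p, q)}) (Y : {RV P >-> 'M[R]_(n * q, p)})
    (X_normal : normal_indep_columns P theta Sigma X)
    (Y_normal : normal_indep_rows P 0 (q%:R^-1 *: Sigma) Y)
    (X_S_indep : independent P X (fun w => (Y w)^T *m Y w)) :
  let S w : 'M[R]_p := (Y w)^T *m Y w in
  let F w : R := \tr ((X w)^T *m mpinv (S w) *m X w) in
  ('E_P[fun w => ((F w)^-1)%R] < +oo)%E <->
  P [set w | (2 < q * \rank (S w))%N] = 1%E.
Proof.
move=> S F.
have uSigma : Sigma \in unitmx by exact: posdefmx_unit.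
have uqSigma : q%:R^-1 *: Sigma \in unitmx.
  by rewrite unitmxZ // unitfE invr_eq0 pnatr_eq0 -lt0n.
have mX : measurable_fun setT X by exact: measurable_funPT.
have mY : measurable_fun setT Y by exact: measurable_funPT.
have mS : measurable_fun setT S by apply: measurable_mulmx => //; exact: measurable_trmx.
have [A [W [z [uA gW XE]]]] := normal_columns_gaussian uSigma X_normal.
have {XE} XE : (X : T -> _) = (fun w => col_mul A (W w + z)) by exact/funext.
pose g w' : \bar R := (\int[P]_w ((loss (Y w') (X w))^-1)%:E)%E.
(* Tonelli wants nonnegativity at every pair, also where the second matrix is not positive
   semidefinite; the absolute value changes nothing at values of [S]. *)
pose f (u : 'M[R]_(p, q) * 'M[R]_p) : \bar R :=
  `|(\tr (u.1^T *m mpinv u.2 *m u.1))^-1|%:E.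
have mf : measurable_fun setT f.
  apply/measurable_EFinP; apply: measurableT_comp => //.
  apply: measurable_funV; apply: measurable_mxtrace.
  have m1 : measurable_fun setT (fst : 'M[R]_(p, q) * 'M[R]_p -> _) by exact: measurable_fst.
  have m2 : measurable_fun setT (snd : 'M[R]_(p, q) * 'M[R]_p -> _) by exact: measurable_snd.
  apply: measurable_mulmx => //; apply: measurable_mulmx; first exact: measurable_trmx.
  exact: measurable_mpinv.
have [|mg EE] := independent_integral mX mS X_S_indep mf.
  by move=> u; rewrite lee_fin.
have fE w w' : f (X w, S w') = ((loss (Y w') (X w))^-1)%:E.
  by rewrite /f /= ger0_norm // invr_ge0 -/(loss _ _) loss_ge0.
have {mg} mg : measurable_fun setT g.
  move: mg; congr (measurable_fun _ _); apply/funext => w'.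
  by apply: eq_integral => w _; rewrite fE.
have {EE} EE : ('E_P[fun w => ((F w)^-1)%R] = \int[P]_w' g w')%E.
  rewrite unlock; transitivity (\int[P]_w f (X w, S w))%E.
    by apply: eq_integral => w _; rewrite fE.
  by rewrite EE; apply: eq_integral => w' _; apply: eq_integral => w _; rewrite fE.
have g0 w' : (0 <= g w')%E.
  by apply: integral_ge0 => w _; rewrite lee_fin invr_ge0 loss_ge0.
have mrank : measurable [set w | (2 < q * \rank (S w))%N].
  have -> : [set w | (2 < q * \rank (S w))%N] =
      [set w | 3 <= q%:R * \tr (S w *m mpinv (S w))].
    by apply/seteqP; split => w /=; rewrite mxtrace_mul_mpinv -natrM ler_nat.
  rewrite -[D in measurable D]setTI.
  suff mt : measurable_fun setT (fun w => q%:R * \tr (S w *m mpinv (S w))).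
    exact: (measurable_fun_ler (measurable_cst _) mt).
  apply: measurable_funM => //.
  by apply: measurable_mxtrace; apply: measurable_mulmx => //; exact: measurable_mpinv.
rewrite EE; split.
- move=> gfin.
  have ig : P.-integrable setT g.
    apply/integrableP; split=> //.
    by under eq_integral => w _ do rewrite gee0_abs //.
  have aeg := integrable_ae measurableT ig.
  have nq_gt0 : (0 < n * q)%N by rewrite muln_gt0 n_gt0.
  have aeY := normal_rows_neq0 nq_gt0 p_gt0 uqSigma Y_normal.
  have PC : P (~` [set w | (2 < q * \rank (S w))%N]) = 0%E.
    apply: (@measure_negligible _ _ _ P); first exact: measurableC.
    suff : {ae P, forall w, (2 < q * \rank (S w))%N} by [].
    apply: filterS2 aeg aeY => w /(_ I) gw Yw; rewrite ltnNge; apply/negP => rk.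
    (* Finiteness of [g] cannot exclude rank 0: there the loss is 0 and so is its inverse, so
       [Y w != 0] is used. *)
    have rk0 : (0 < q * \rank (S w))%N.
      rewrite muln_gt0 q_gt0 lt0n mxrank_eq0; apply: contra Yw => /eqP S0.
      by rewrite -mxdot_eq0 mxdotE -/(S w) S0 linear0.
    move: gw; rewrite /g XE integral_inv_loss_infty //.
    by rewrite rk0.
  have := probability_setC P (measurableC mrank); rewrite setCK => ->.
  by rewrite PC sube0.
- move=> P1.
  have aerk : {ae P, forall w, (2 < q * \rank (S w))%N}.
    exists (~` [set w | (2 < q * \rank (S w))%N]); split => //.
      exact: measurableC.
    by rewrite probability_setC // P1 subee.
  have [K K0 KP] := integral_inv_loss_le uA gW z.
  have mYY : measurable_fun setT (fun w => mxdot (Y w) (Y w)).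
    move/measurable_mxP : mY => mY; apply: measurable_sum => i; apply: measurable_sum => j.
    exact: measurable_funM.
  (* The majorant is [K] times the trace of [S], with [K] independent of [w]. *)
  apply: (@le_lt_trans _ _ (\int[P]_w (K%:E * (mxdot (Y w) (Y w))%:E))%E).
    apply: ae_ge0_le_integral => //.
    + by move=> w _; rewrite -EFinM lee_fin mulr_ge0 ?mxdot_ge0.
    + by apply/measurable_EFinP; exact: measurable_funM.
    + apply: filterS aerk => w rk _; rewrite /g XE.
      exact: KP.
  rewrite ge0_integralZl_EFin //.
  + apply: lte_mul_pinfty; rewrite ?lee_fin //.
    exact: normal_rows_integral mY Y_normal.
  + by move=> w _; rewrite lee_fin mxdot_ge0.
  + exact/measurable_EFinP.
Qed.
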